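(* Let $n,d\ge 1$ and $0\le k<d$ be integers. The canonical module of the Veronese module $S_{n,d,k}$ is (isomorphic, up to a shift in the grading, to) the Veronese module $S_{n,d,t}$, where $t\equiv -n-k \pmod d$ and $0\le t<d$.
   Context: $\mathbb{K}$ is an arbitrary field and $S=\mathbb{K}[x_1,\dots,x_n]$ with the standard grading, $S_j$ denoting its degree-$j$ component. The Veronese module is $S_{n,d,k}=\bigoplus_{i\ge 0}S_{k+id}$; for $k=0$ this is the $d$-th Veronese ring $S^{(d)}=S_{n,d,0}$, and $S_{n,d,k}$ is an $S^{(d)}$-module. Let $N=\binom{n+d-1}{d}$ and $R=\mathbb{K}[y_1,\dots,y_N]$, with the surjection $R\to S^{(d)}$ sending the $y_i$ to the $N$ monomials of degree $d$ in $x_1,\dots,x_n$; via this map $S_{n,d,k}$ is a finitely generated graded $R$-module. For $k<d$ the module $S_{n,d,k}$ is Cohen--Macaulay. The canonical module of a finitely generated graded Cohen--Macaulay $R$-module $M$ of projective dimension $p$ is $\omega_M=\operatorname{Ext}^p_R(M,R)$ (determined here up to a shift in the grading). *)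

(* Defs.v *)
From HB Require Import structures.
From mathcomp Require Import all_boot all_order all_algebra.
From mathcomp Require Import boolp.
From mathcomp Require Import mpoly.

Set Implicit Arguments.
Unset Strict Implicit.
Unset Printing Implicit Defensive.

Import Order.TTheory GRing.Theory Num.Theory.
Local Open Scope ring_scope.
Local Open Scope quotient_scope.

(* ring_quotient only gives quotients of Z-modules and of rings; this is the  *)
(* quotient of an R-module by a submodule.                                    *)
Section QuotientModule.
Variables (R : comNzRingType) (V : lmodType R) (W : zmodClosed V).
Hypothesis scaleW : GRing.scaler_closed W.

Definition quotmod of GRing.scaler_closed W : Type := Quotient.quot W.
Local Notation Q := (quotmod scaleW).

HB.instance Definition _ := GRing.Zmodule.copy Q (Quotient.quot W).

Definition quotmod_pi (x : V) : Q := \pi_(Quotient.quot W) x.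

Definition quotmod_scale (a : R) (q : Q) : Q :=
  quotmod_pi (a *: repr (q : Quotient.quot W)).

Fact quotmod_scaleE a x :
  quotmod_scale a (quotmod_pi x) = quotmod_pi (a *: x).
Proof.
apply/eqP; rewrite -Quotient.idealrBE -scalerBr; apply: scaleW.
by rewrite Quotient.idealrBE reprK.
Qed.

Fact quotmod_piD x y : quotmod_pi (x + y) = quotmod_pi x + quotmod_pi y.
Proof. exact: Quotient.pi_add. Qed.

Fact quotmod_ind (P : Q -> Prop) : (forall x, P (quotmod_pi x)) -> forall q, P q.
Proof. by move=> h q; rewrite -[q](reprK (q : Quotient.quot W)). Qed.

Fact quotmod_scaleA a b q :
  quotmod_scale a (quotmod_scale b q) = quotmod_scale (a * b) q.
Proof. by elim/quotmod_ind: q => x; rewrite !quotmod_scaleE scalerA. Qed.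

Fact quotmod_scale1 : left_id 1 quotmod_scale.
Proof. by elim/quotmod_ind=> x; rewrite quotmod_scaleE scale1r. Qed.

Fact quotmod_scaleDr : right_distributive quotmod_scale +%R.
Proof.
move=> a; elim/quotmod_ind=> x; elim/quotmod_ind=> y.
by rewrite -quotmod_piD !quotmod_scaleE scalerDr quotmod_piD.
Qed.

Fact quotmod_scaleDl q : {morph quotmod_scale^~ q : a b / a + b}.
Proof.
by move=> a b; elim/quotmod_ind: q => x; rewrite !quotmod_scaleE scalerDl quotmod_piD.
Qed.

HB.instance Definition _ := GRing.Zmodule_isLmodule.Build R Q
  quotmod_scaleA quotmod_scale1 quotmod_scaleDr quotmod_scaleDl.

End QuotientModule.

(* The middle cohomology ker (B *m _) / im (A *m _) of R^l --A--> R^m --B--> R^q. *)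
Section Cohomology.
Variables (R : comNzRingType) (l m q : nat).
Variables (A : 'M[R]_(m, l)) (B : 'M[R]_(q, m)).

Definition cocycle_pred : {pred 'cV[R]_m} := fun c => B *m c == 0.

Fact cocycle_submod : GRing.submod_closed cocycle_pred.
Proof.
split=> [|a x y]; rewrite !unfold_in ?mulmx0 // => /eqP Bx /eqP By.
by rewrite mulmxDr -scalemxAr Bx By scaler0 addr0.
Qed.
HB.instance Definition _ :=
  GRing.isSubmodClosed.Build R 'cV[R]_m cocycle_pred cocycle_submod.

Record cocycle := Cocycle { cocycle_val :> 'cV[R]_m; _ : cocycle_val \in cocycle_pred }.
HB.instance Definition _ := [isSub for cocycle_val].
HB.instance Definition _ := [Choice of cocycle by <:].
HB.instance Definition _ := [SubChoice_isSubLmodule of cocycle by <:].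

Definition coboundary : {pred cocycle} :=
  fun z => `[< exists b : 'cV[R]_l, val z = A *m b >].

Fact coboundary_zmod : zmod_closed coboundary.
Proof.
split=> [|x y]; rewrite !unfold_in; first by apply/asboolP; exists 0; rewrite mulmx0.
move=> /asboolP[b xE] /asboolP[c yE]; apply/asboolP; exists (b - c).
by rewrite raddfB /= mulmxBr -xE -yE.
Qed.
HB.instance Definition _ :=
  GRing.isZmodClosed.Build cocycle coboundary coboundary_zmod.

Fact coboundary_scale : GRing.scaler_closed coboundary.
Proof.
move=> a x; rewrite !unfold_in => /asboolP[b xE]; apply/asboolP; exists (a *: b).
by rewrite -scalemxAr -xE.
Qed.

Definition cohomology : Type := quotmod coboundary_scale.
HB.instance Definition _ := GRing.Lmodule.on cohomology.

Definition cohomology_class (z : cocycle) : cohomology := quotmod_pi coboundary_scale z.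

End Cohomology.

Section ProjectiveDimension.
Variable R : comNzRingType.

Definition projective (P : lmodType R) : Prop :=
  forall (U V : lmodType R) (g : {linear U -> V}) (f : {linear P -> V}),
    (forall v, exists u, g u = v) ->
    exists h : {linear P -> U}, forall x, g (h x) = f x.

Record projective_resolution (M : lmodType R) := ProjectiveResolution {
  pr_mod : nat -> lmodType R;
  pr_diff : forall i, {linear pr_mod i.+1 -> pr_mod i};
  pr_aug : {linear pr_mod 0%N -> M};
  pr_projective : forall i, projective (pr_mod i);
  pr_aug_surj : forall y, exists x, pr_aug x = y;
  pr_aug_exact : forall x, pr_aug x = 0 <-> exists y, x = pr_diff 0 y;
  pr_diff_exact : forall i x, pr_diff i x = 0 <-> exists y, x = pr_diff i.+1 y
}.

Definition has_projective_resolution_le (M : lmodType R) (p : nat) : Prop :=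
  exists P : projective_resolution M,
    forall i, (p < i)%N -> forall x : pr_mod P i, x = 0.

Definition has_projective_dimension (M : lmodType R) (p : nat) : Prop :=
  has_projective_resolution_le M p /\
  forall q, has_projective_resolution_le M q -> (p <= q)%N.

End ProjectiveDimension.

(* Gradings are indexed by int and given by a predicate Mdeg, where Mdeg j x  *)
(* says that x lies in the degree j component; 0 lies in all of them.         *)
Definition homogeneous (K : fieldType) (N : nat) (j : int) (f : {mpoly K[N]}) : Prop :=
  forall m, m \in msupp f -> (mdeg m)%:Z = j.

Section GradedExt.
Variables (K : fieldType) (N : nat).
Local Notation R := {mpoly K[N]}.

(* The free module with basis e_b in degree a b, i.e. the sum of the R(- a b). *)
Definition free_homogeneous r (a : 'I_r -> int) (j : int) (x : 'rV[R]_r) : Prop :=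
  forall b, homogeneous (j - a b) (x 0 b).

(* Resolutions by finitely generated graded free modules, with maps of degree *)
(* 0; the matrix gf_diff i acts on row vectors on the right.                  *)
Record graded_free_resolution (M : lmodType R) (Mdeg : int -> M -> Prop) :=
  GradedFreeResolution {
    gf_rank : nat -> nat;
    gf_deg : forall i, 'I_(gf_rank i) -> int;
    gf_diff : forall i, 'M[R]_(gf_rank i.+1, gf_rank i);
    gf_aug : {linear 'rV[R]_(gf_rank 0%N) -> M};
    gf_aug_surj : forall y, exists x, gf_aug x = y;
    gf_aug_exact : forall x, gf_aug x = 0 <-> exists y, x = y *m gf_diff 0;
    gf_diff_exact : forall i (x : 'rV[R]_(gf_rank i.+1)),
      x *m gf_diff i = 0 <-> exists y : 'rV[R]_(gf_rank i.+2), x = y *m gf_diff i.+1;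
    gf_aug_graded : forall j x,
      free_homogeneous (@gf_deg 0%N) j x -> Mdeg j (gf_aug x);
    gf_diff_graded : forall i j x,
      free_homogeneous (@gf_deg i.+1) j x ->
      free_homogeneous (@gf_deg i) j (x *m gf_diff i)
  }.
Arguments gf_deg {M Mdeg} g i b.

Section Ext.
Variables (M : lmodType R) (Mdeg : int -> M -> Prop).
Variables (F : graded_free_resolution Mdeg) (p : nat).

Definition gf_rank_in : nat := if p is q.+1 then gf_rank F q else 0.

Definition gf_diff_in : 'M[R]_(gf_rank F p, gf_rank_in) :=
  match p return 'M_(gf_rank F p, if p is q.+1 then gf_rank F q else 0) with
  | 0 => 0
  | q.+1 => gf_diff F q
  end.

(* Ext^p_R(M, R) computed from F: Hom_R(R^r, R) is identified with column     *)
(* vectors c, acting as x |-> x *m c, so the dual of (_ *m D) is (D *m _).    *)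
Definition Ext : Type := cohomology gf_diff_in (gf_diff F p).
HB.instance Definition _ := GRing.Lmodule.on Ext.

(* Homogeneous of degree j: represented by a cocycle F_p -> R of degree j,    *)
(* i.e. one sending the basis vector e_b into degree gf_deg F p b + j.        *)
Definition Ext_deg (j : int) (x : Ext) : Prop :=
  exists2 z : cocycle (gf_diff F p), x = cohomology_class gf_diff_in z &
    forall b, homogeneous (gf_deg F p b + j) (cocycle_val z b 0).

End Ext.

Definition graded_iso_up_to_shift (M W : lmodType R)
    (Mdeg : int -> M -> Prop) (Wdeg : int -> W -> Prop) : Prop :=
  exists (s : int) (f : {linear M -> W}),
    bijective f /\ forall j x, Mdeg j x <-> Wdeg (j + s) (f x).

(* W is, up to isomorphism and shift, the module Ext^p_R(M, R), p = pd M,     *)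
(* whichever resolution is used to compute it.                                *)
Definition is_canonical_module (M W : lmodType R)
    (Mdeg : int -> M -> Prop) (Wdeg : int -> W -> Prop) : Prop :=
  exists p : nat,
    [/\ has_projective_dimension M p,
        inhabited (graded_free_resolution Mdeg) &
        forall F : graded_free_resolution Mdeg,
          graded_iso_up_to_shift (@Ext_deg M Mdeg F p) Wdeg].

End GradedExt.

(* An enumeration of the monomials of degree d in n >= 1 variables. *)
Structure monomial_enum (n d : nat) := MonomialEnum {
  monomials :> 'C((n + d).-1, d).-tuple 'X_{1..n};
  monomials_uniq : uniq monomials;
  monomials_mem : monomials =i [pred m | mdeg m == d]
}.

Fact monomial_enum_inhabited n d : (0 < n)%N -> inhabited (monomial_enum n d).
Proof.
case: n => // n _; set b := [seq s2m (val t) | t <- enum (basis n.+1 d)].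
have sz : size b == 'C((n.+1 + d).-1, d) by rewrite size_basis addnC addSn.
split; apply: (@MonomialEnum _ _ (Tuple sz)); first exact: uniq_basis.
by move=> m; rewrite inE basis_cover.
Qed.

Section VeronesePred.
Variables (K : fieldType) (n d : nat).

(* The sum of the S_(k + i d), i >= 0. *)
Definition veronese_pred (k : nat) : {pred {mpoly K[n]}} :=
  fun f => all [pred m | (k <= mdeg m)%N && (d %| mdeg m - k)%N] (msupp f).

Fact veronese_predP k f : reflect
  {in msupp f, forall m, exists i, mdeg m = (k + i * d)%N} (f \in veronese_pred k).
Proof.
apply: (iffP allP) => h m /h /=; last first.
  by case=> i ->; rewrite leq_addr addKn dvdn_mull.
by case/andP=> le_km /dvdnP[i iE]; exists i; rewrite -iE subnKC.
Qed.

Fact veronese_submod k : GRing.submod_closed (veronese_pred k).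
Proof.
split=> [|a f g /veronese_predP hf /veronese_predP hg]; apply/veronese_predP.
  by move=> m; rewrite msupp0.
move=> m /msuppD_le; rewrite mem_cat => /orP[/msuppZ_le|]; [exact: hf|exact: hg].
Qed.
HB.instance Definition _ k :=
  GRing.isSubmodClosed.Build K {mpoly K[n]} (veronese_pred k) (veronese_submod k).

End VeronesePred.

(* Indexed by e because the R-module structure depends on it. *)
Record veronese (K : fieldType) (n d : nat) (e : monomial_enum n d) (k : nat) :=
  Veronese {
    veronese_val :> {mpoly K[n]};
    veronese_valP : veronese_val \in veronese_pred d k
  }.
Arguments Veronese {K n d e k veronese_val}.
Arguments veronese K {n d}.

Section Veronese.
Variables (K : fieldType) (n d : nat) (e : monomial_enum n d).
Local Notation R := {mpoly K['C((n + d).-1, d)]}.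

Definition veronese_map (r : R) : {mpoly K[n]} :=
  r \mPo [tuple 'X_[tnth e i] | i < 'C((n + d).-1, d)].

Fact veronese_map_homog r m : m \in msupp (veronese_map r) -> (d %| mdeg m)%N.
Proof.
rewrite /veronese_map comp_mpolyE => /msupp_sum_le /flattenP[s /mapP[u _ ->]].
move/msuppZ_le; set q := \prod_(i < _) _ => mq.
suff /dhomogP/(_ _ mq) -> : q \is (\sum_i d * u i).-homog.
  by apply: dvdn_sum => i _; apply: dvdn_mulr.
rewrite /q; elim/big_ind2: _ => [|? ? ? ? ? ?|i _]; [exact: dhomog1|exact: dhomogM|].
apply: dhomogMn; rewrite tnth_mktuple dhomogX /=.
by have := mem_tnth i e; rewrite monomials_mem.
Qed.

Fact veronese_scale_in k r f :
  f \in veronese_pred d k -> veronese_map r * f \in veronese_pred d k.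
Proof.
move=> /veronese_predP hf; apply/veronese_predP => m /msuppM_le.
case/allpairsP=> -[u v] /= [/veronese_map_homog/dvdnP[j uE] /hf[i vE] ->].
by exists (i + j)%N; rewrite mdegD uE vE mulnDl addnCA addnA addnAC addnA.
Qed.

Variable k : nat.
Local Notation S := (veronese K e k).

HB.instance Definition _ := [isSub for @veronese_val K n d e k].
HB.instance Definition _ := [Choice of S by <:].
HB.instance Definition _ := [SubChoice_isSubZmodule of S by <:].

Definition veronese_scale (r : R) (f : S) : S :=
  Veronese (veronese_scale_in r (veronese_valP f)).

Fact veronese_scaleA a b f :
  veronese_scale a (veronese_scale b f) = veronese_scale (a * b) f.
Proof. by apply: val_inj; rewrite /= /veronese_map rmorphM mulrA. Qed.

Fact veronese_scale1 : left_id 1 veronese_scale.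
Proof. by move=> f; apply: val_inj; rewrite /= /veronese_map rmorph1 mul1r. Qed.

Fact veronese_scaleDr : right_distributive veronese_scale +%R.
Proof. by move=> a f g; apply: val_inj; rewrite /= mulrDr. Qed.

Fact veronese_scaleDl f : {morph veronese_scale^~ f : a b / a + b}.
Proof. by move=> a b; apply: val_inj; rewrite /= /veronese_map rmorphD mulrDl. Qed.

HB.instance Definition _ := GRing.Zmodule_isLmodule.Build R S
  veronese_scaleA veronese_scale1 veronese_scaleDr veronese_scaleDl.

(* The degree i component is S_(k + i d), so that each y_i has degree 1. *)
Definition veronese_deg (j : int) (f : S) : Prop :=
  homogeneous (k%:Z + j * d%:Z) (veronese_val f).

End Veronese.

(* Main.v *)
(* Let A be the subring of R generated by the variables y_i mapped to the pure  *)
(* powers x_j^d. The monomials x^b with all b_j < d and |b| = k mod d form a     *)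
(* basis of S_(n,d,k) over A, so S_(n,d,k) is the quotient of the free R-module  *)
(* on these monomials by the commuting operators                                 *)
(*   T_i = y_i - (multiplication by x^(e_i)),   y_i not sent to a pure power,    *)
(* which form a regular sequence: eliminating y_i through y_i := x^(e_i) turns   *)
(* the successive quotients into submodules of polynomial rings. The Koszul      *)
(* complex of the T_i is thus a graded free resolution of S_(n,d,k), and the top *)
(* cohomology of its dual is the cokernel of the transposed operators. Those are *)
(* the operators attached to the complementary monomials x^((d-1,...,d-1) - b),  *)
(* whose degree is -n-k mod d, so this cokernel is S_(n,d,t). It is nonzero,     *)
(* hence the length of the Koszul complex is the projective dimension.           *)

Require Import Defs.
From HB Require Import structures.
From mathcomp Require Import all_boot all_order all_algebra.
From mathcomp Require Import boolp mpoly zify ring.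

Set Implicit Arguments.
Unset Strict Implicit.
Unset Printing Implicit Defensive.

Import GRing.Theory.
Local Open Scope ring_scope.

(** * Homogeneous parts *)

(** The duality comes from the complement b |-> (d-1,...,d-1) - b. Since n(d-1) = k + t mod d, it
    exchanges the monomial generators of S_(n,d,k) and S_(n,d,t) over the subring of pure powers
    ([residue_basis_compl]), and it transposes the operators T_l presenting the two modules
    ([relation_mx_tr]).

    The Koszul complex of commuting operators that form a regular sequence resolves their common
    cokernel ([koszul_exact]), and the top cohomology of its dual is the common cokernel of the
    transposes ([top_coboundsP]). Regularity is checked in the domain K[x,y]: [eval] embeds each
    successive quotient of R^r there, and the next operator becomes multiplication by the nonzero
    element y_l - x^(e_l) ([eval_inj], [eval_setU1P], [eval_regular]). So the top Ext computed from
    the Koszul resolution is S_(n,d,t), up to a shift.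

    Two points remain, both settled by lifting maps and homotopies between resolutions
    ([resolution_map], [resolution_homotopy]). The length of the complex is the projective
    dimension, because a shorter projective resolution would kill the nonzero top cohomology
    ([cobounds_short]). Any other graded free resolution gives the same graded module, because
    comparison maps can be replaced by their degree 0 parts ([ext_iso]). *)

Section HomogeneousProjection.
Variables (K : fieldType) (n : nat).
Implicit Types (f g : {mpoly K[n]}) (i j : int).

Definition hproj j f : {mpoly K[n]} :=
  \sum_(m <- msupp f | (mdeg m)%:Z == j) f@_m *: 'X_[m].

Lemma mcoeff_hproj j f m : (hproj j f)@_m = if (mdeg m)%:Z == j then f@_m else 0.
Proof.
rewrite /hproj raddf_sum /=.
under eq_bigr => u _ do rewrite mcoeffZ mcoeffX.
have [mf|/memN_msupp_eq0 fm0] := boolP (m \in msupp f); last first.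
  rewrite fm0 if_same big1 // => u _.
  by case: eqP => [->|_]; rewrite ?fm0 (mul0r, mulr0).
rewrite big_mkcond (bigD1_seq m) ?msupp_uniq //= eqxx mulr1 big1 ?addr0 // => u um.
by rewrite (negPf um) mulr0 if_same.
Qed.

Fact hproj_is_linear j : linear (hproj j).
Proof.
move=> c f g; apply/mpolyP => m; rewrite mcoeffD mcoeffZ !mcoeff_hproj.
by case: ifP => _; rewrite ?mulr0 ?addr0 // mcoeffD mcoeffZ.
Qed.
HB.instance Definition _ j :=
  GRing.isLinear.Build K {mpoly K[n]} {mpoly K[n]} _ (hproj j) (hproj_is_linear j).

Lemma hproj_homogeneous j f : homogeneous j (hproj j f).
Proof.
by move=> m; rewrite mcoeff_msupp mcoeff_hproj; case: ifP => [/eqP //|]; rewrite eqxx.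
Qed.

(** Homogeneity becomes a fixed-point equation for a linear map, so closure under sums and
    differences follows from linearity. *)
Lemma hproj_id j f : homogeneous j f <-> hproj j f = f.
Proof.
split=> [hf|<-]; last exact: hproj_homogeneous.
apply/mpolyP => m; rewrite mcoeff_hproj; case: eqP => // jm.
by apply/esym/memN_msupp_eq0/negP => /hf.
Qed.

Lemma hprojX j m : hproj j 'X_[m] = if (mdeg m)%:Z == j then 'X_[m] else 0.
Proof.
apply/mpolyP => u; rewrite mcoeff_hproj mcoeffX.
case: (eqVneq m u) => [->|mu]; first by case: ifP; rewrite ?mcoeffX ?eqxx ?mcoeff0.
by case: ifP; case: ifP; rewrite ?mcoeffX ?mcoeff0 ?(negPf mu).
Qed.

Lemma hprojM i j f g : homogeneous i f -> hproj (i + j) (f * g) = f * hproj j g.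
Proof.
move=> hf; rewrite {1}[f]mpolyE {1}[g]mpolyE mulr_suml linear_sum /=.
rewrite {3}[f]mpolyE mulr_suml; apply: eq_big_seq => u /hf ui.
rewrite {3}[g]mpolyE linear_sum mulr_sumr linear_sum mulr_sumr /=.
apply: eq_bigr => v _; rewrite -scalerAl -scalerAr -mpolyXD !linearZ /= !hprojX.
rewrite mdegD PoszD ui (inj_eq (addrI i)).
by case: ifP; rewrite -?scalerAl -?scalerAr ?mpolyXD // mulr0 !scaler0.
Qed.

Lemma homogeneousM i j f g :
  homogeneous i f -> homogeneous j g -> homogeneous (i + j) (f * g).
Proof. by move=> hf /hproj_id hg; apply/hproj_id; rewrite hprojM // hg. Qed.

Lemma homogeneousX m : homogeneous (mdeg m)%:Z ('X_[m] : {mpoly K[n]}).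
Proof. by apply/hproj_id; rewrite hprojX eqxx. Qed.

Lemma homogeneous0 j : homogeneous j (0 : {mpoly K[n]}).
Proof. by apply/hproj_id; rewrite linear0. Qed.

Lemma homogeneousN j f : homogeneous j f -> homogeneous j (- f).
Proof. by move=> /hproj_id hf; apply/hproj_id; rewrite linearN /= hf. Qed.

Lemma homogeneousB j f g :
  homogeneous j f -> homogeneous j g -> homogeneous j (f - g).
Proof. by move=> /hproj_id hf /hproj_id hg; apply/hproj_id; rewrite linearB /= hf hg. Qed.

Lemma homogeneous_sum j (I : Type) (r : seq I) (P : pred I) (F : I -> {mpoly K[n]}) :
  (forall l, P l -> homogeneous j (F l)) -> homogeneous j (\sum_(l <- r | P l) F l).
Proof.
move=> hF; apply/hproj_id; rewrite linear_sum.
by apply: eq_bigr => l /hF /hproj_id.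
Qed.

Lemma homogeneous1 : homogeneous 0 (1 : {mpoly K[n]}).
Proof. by rewrite -mpolyX0 -[0]/(0%N : int) -(@mdeg0 n); apply: homogeneousX. Qed.

End HomogeneousProjection.

(** * Degree 0 maps between graded free modules *)

Section GradedMatrices.
Variables (K : fieldType) (N : nat).
Local Notation R := {mpoly K[N]}.

(** With basis degrees [a] on the source and [b] on the target, these are the matrices of degree 0
    maps, acting on row vectors. *)
Definition hmatrix p q (a : 'I_p -> int) (b : 'I_q -> int) (D : 'M[R]_(p, q)) :=
  forall i j, homogeneous (a i - b j) (D i j).

Definition hpart p q (a : 'I_p -> int) (b : 'I_q -> int) (D : 'M[R]_(p, q)) : 'M[R]_(p, q) :=
  \matrix_(i, j) hproj (a i - b j) (D i j).

Lemma hmatrix_hpart p q (a : 'I_p -> int) (b : 'I_q -> int) D :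
  hmatrix a b (hpart a b D).
Proof. by move=> i j; rewrite mxE; apply: hproj_homogeneous. Qed.

Lemma hpart_id p q (a : 'I_p -> int) (b : 'I_q -> int) D :
  hmatrix a b D -> hpart a b D = D.
Proof. by move=> hD; apply/matrixP=> i j; rewrite mxE; apply/hproj_id. Qed.

(** Together with [hpart_mulr], this shows that the degree 0 part of a chain map between graded
    complexes still commutes with the differentials. *)
Lemma hpart_mull p q s (a : 'I_p -> int) (b : 'I_q -> int) (c : 'I_s -> int) A D :
  hmatrix a b A -> hpart a c (A *m D) = A *m hpart b c D.
Proof.
move=> hA; apply/matrixP=> i j; rewrite !mxE linear_sum /=.
apply: eq_bigr => l _; rewrite mxE -(hprojM _ _ (hA i l)).
by congr hproj; rewrite addrA subrK.
Qed.

Lemma hpart_mulr p q s (a : 'I_p -> int) (b : 'I_q -> int) (c : 'I_s -> int) A D :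
  hmatrix b c D -> hpart a c (A *m D) = hpart a b A *m D.
Proof.
move=> hD; apply/matrixP=> i j; rewrite !mxE linear_sum /=.
apply: eq_bigr => l _; rewrite mxE [RHS]mulrC -(hprojM _ _ (hD l j)) mulrC.
by congr hproj; rewrite [RHS]addrC addrA subrK.
Qed.

End GradedMatrices.

(** * Comparison of projective resolutions *)

Section Image.
Variables (R : comNzRingType) (U V : lmodType R) (g : {linear U -> V}).

Definition image_pred : {pred V} := fun v => `[< exists u, v = g u >].

Fact image_submod : GRing.submod_closed image_pred.
Proof.
split=> [|a x y]; rewrite !unfold_in; first by apply/asboolP; exists 0; rewrite linear0.
move=> /asboolP[u ->] /asboolP[w ->]; apply/asboolP; exists (a *: u + w).
by rewrite linearP.
Qed.
HB.instance Definition _ := GRing.isSubmodClosed.Build R V image_pred image_submod.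

Record image := Image { image_val :> V; image_valP : image_val \in image_pred }.
HB.instance Definition _ := [isSub for image_val].
HB.instance Definition _ := [Choice of image by <:].
HB.instance Definition _ := [SubChoice_isSubLmodule of image by <:].

Section Corestriction.
Variables (P : lmodType R) (f : {linear P -> V}).
Hypothesis fg : forall x, f x \in image_pred.

Definition corestr (x : P) : image := Image (fg x).

Fact corestr_is_linear : linear corestr.
Proof. by move=> a x y; apply: val_inj; rewrite linearP /= linearP. Qed.
HB.instance Definition _ := GRing.isLinear.Build R P image _ corestr corestr_is_linear.
End Corestriction.

End Image.

(** [projective] only lifts along surjections, so [g] and [f] are corestricted to the image of
    [g]. *)
Lemma projective_lift (R : comNzRingType) (P U V : lmodType R) (g : {linear U -> V})
    (f : {linear P -> V}) : projective P -> (forall x, exists u, f x = g u) ->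
  exists h : {linear P -> U}, forall x, g (h x) = f x.
Proof.
move=> projP fg.
have fgP x : f x \in image_pred g by apply/asboolP.
have gP x : g x \in image_pred g by apply/asboolP; exists x.
have [|h hP] := projP _ _ (corestr gP : {linear U -> image g}) (corestr fgP).
  by case=> v /[dup] /asboolP[u ->] vP; exists u; apply: val_inj.
by exists h => x; have /(congr1 val) := hP x.
Qed.

Section FreeModule.
Variables (R : comNzRingType) (r : nat) (U : lmodType R) (u : 'I_r -> U).

Definition row_comb (x : 'rV[R]_r) : U := \sum_b x 0 b *: u b.

Fact row_comb_is_linear : linear row_comb.
Proof.
move=> a x y; rewrite scaler_sumr -big_split; apply: eq_bigr => b _.
by rewrite !mxE scalerDl scalerA.
Qed.
HB.instance Definition _ := GRing.isLinear.Build R 'rV[R]_r U _ row_comb row_comb_is_linear.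

Lemma row_comb_delta b : row_comb (delta_mx 0 b) = u b.
Proof.
rewrite /row_comb (bigD1 b) //= mxE !eqxx scale1r big1 ?addr0 // => i ib.
by rewrite mxE (negPf ib) andbF scale0r.
Qed.

Lemma row_comb_lin (f : {linear 'rV[R]_r -> U}) :
  (forall b, f (delta_mx 0 b) = u b) -> f =1 row_comb.
Proof.
move=> fu x; rewrite {1}[x]row_sum_delta linear_sum; apply: eq_bigr => b _.
by rewrite linearZ /= fu.
Qed.
End FreeModule.

Lemma projective_rV (R : comNzRingType) r : projective 'rV[R]_r.
Proof.
move=> U V g f g_surj; have [u uP] := choice (fun b => g_surj (f (delta_mx 0 b))).
exists (row_comb u) => x; rewrite [RHS](row_comb_lin (fun=> erefl)) linear_sum.
by apply: eq_bigr => b _; rewrite linearZ /= uP.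
Qed.

Lemma dependent_choice_nat (T : nat -> Type) (rel : forall i, T i -> T i.+1 -> Prop)
    (x0 : T 0%N) : (forall i x, exists y, rel i x y) ->
  exists f : forall i, T i, f 0%N = x0 /\ forall i, rel i (f i) (f i.+1).
Proof.
move=> total; pose step i x := projT1 (cid (total i x)).
exists (fun i => nat_rect T x0 step i); split=> // i.
exact: projT2 (cid (total i _)).
Qed.

Section Comparison.
Variables (R : comNzRingType) (M : lmodType R).
Implicit Types P Q : projective_resolution M.

Lemma pr_diffK P i x : pr_diff P i (pr_diff P i.+1 x) = 0.
Proof. by apply/pr_diff_exact; exists x. Qed.

Lemma resolution_map P Q :
  exists f : forall i, {linear pr_mod P i -> pr_mod Q i},
    (forall x, pr_aug Q (f 0%N x) = pr_aug P x) /\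
    forall i x, pr_diff Q i (f i.+1 x) = f i (pr_diff P i x).
Proof.
(* The invariant that permits the next lift. Dependent choice runs over maps bundled with it. *)
pose good i (f : {linear pr_mod P i -> pr_mod Q i}) :=
  forall x, exists y, f (pr_diff P i x) = pr_diff Q i y.
have [f0 f0E] := @pr_projective _ _ P 0%N _ _ (pr_aug Q) (pr_aug P) (pr_aug_surj Q).
have good0 : good 0%N f0.
  by move=> x; apply/pr_aug_exact; rewrite f0E; apply/pr_aug_exact; exists x.
pose rel i (f : {f | good i f}) (f' : {f | good i.+1 f}) :=
  forall x, pr_diff Q i (sval f' x) = sval f (pr_diff P i x).
have [|f [f0eq fP]] := @dependent_choice_nat _ rel (exist _ f0 good0).
  move=> i [f fgood].
  have [g gE] := projective_lift (f := f \o pr_diff P i) (@pr_projective _ _ P i.+1) fgood.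
  suff ggood : good i.+1 g by exists (exist _ g ggood).
  by move=> x; apply/pr_diff_exact; rewrite gE /= pr_diffK linear0.
exists (fun i => sval (f i)); split=> [x|]; last exact: fP.
by rewrite f0eq /= f0E.
Qed.

Lemma resolution_homotopy P (f : forall i, {linear pr_mod P i -> pr_mod P i}) :
    (forall x, pr_aug P (f 0%N x) = 0) ->
    (forall i x, pr_diff P i (f i.+1 x) = f i (pr_diff P i x)) ->
  exists h : forall i, {linear pr_mod P i -> pr_mod P i.+1},
    (forall x, f 0%N x = pr_diff P 0 (h 0%N x)) /\
    forall i x, f i.+1 x = pr_diff P i.+1 (h i.+1 x) + h i (pr_diff P i x).
Proof.
move=> f0 fd.
(* The next component of the homotopy is a lift of f - h d along the differential; this invariant
   makes it possible. *)
pose good i (h : {linear pr_mod P i -> pr_mod P i.+1}) :=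
  forall x, exists y, f i.+1 x - h (pr_diff P i x) = pr_diff P i.+1 y.
have [|h0 h0E] := projective_lift (g := pr_diff P 0) (f := f 0%N) (@pr_projective _ _ P 0%N).
  by move=> x; apply/pr_aug_exact.
have good0 : good 0%N h0.
  by move=> x; apply/pr_diff_exact; rewrite linearB /= fd h0E subrr.
pose rel i (h : {h | good i h}) (h' : {h | good i.+1 h}) :=
  forall x, pr_diff P i.+1 (sval h' x) = f i.+1 x - sval h (pr_diff P i x).
have [|h [h0eq hP]] := @dependent_choice_nat _ rel (exist _ h0 good0).
  move=> i [h hgood].
  have [g gE] := projective_lift (f := f i.+1 \- (h \o pr_diff P i))
    (@pr_projective _ _ P i.+1) hgood.
  suff ggood : good i.+1 g by exists (exist _ g ggood).
  move=> x; apply/pr_diff_exact; rewrite linearB /= fd gE /= pr_diffK linear0.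
  by rewrite subr0 subrr.
exists (fun i => sval (h i)); split=> [x|i x]; first by rewrite h0eq /= h0E.
by rewrite hP subrK.
Qed.

End Comparison.

(** * The Koszul complex as an iterated cone *)

Section Koszul.
Variables (R : comNzRingType) (r : nat) (T : nat -> 'M[R]_r).

(* Ranks of the Koszul complex of T 0, ..., T (j - 1) on R^r: adjoining T j   *)
(* takes the mapping cone of T j. Homological degree 0 is split off so that   *)
(* [koszul_rank j 0] is convertible to r for a variable j.                    *)
Fixpoint koszul_rankS (j i : nat) : nat :=
  if j is j'.+1 then (koszul_rankS j' i + if i is i'.+1 then koszul_rankS j' i' else r)%N else 0%N.

Definition koszul_rank j i := if i is i'.+1 then koszul_rankS j i' else r.

(* The chain endomorphism induced by an endomorphism X of R^r. *)
Section Diagonal.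
Variable X : 'M[R]_r.

Fixpoint koszul_diagS (j : nat) : forall i, 'M[R]_(koszul_rankS j i) :=
  match j return forall i, 'M[R]_(koszul_rankS j i) with
  | 0 => fun i => 0
  | j'.+1 => fun i => block_mx (koszul_diagS j' i) 0 0
      (match i return 'M[R]_(koszul_rank j' i) with 0 => X | i'.+1 => koszul_diagS j' i' end)
  end.

Definition koszul_diag j i : 'M[R]_(koszul_rank j i) := if i is i'.+1 then koszul_diagS j i' else X.

End Diagonal.

(** On rows, the cone differential (x1, x2) |-> (x1 d + x2 T_j, - x2 d); the second component is
    absent when the target is in homological degree 0. *)
Fixpoint koszul_diff (j : nat) : forall i, 'M[R]_(koszul_rankS j i, koszul_rank j i) :=
  match j return forall i, 'M[R]_(koszul_rankS j i, koszul_rank j i) with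
  | 0 => fun i => 0
  | j'.+1 => fun i => match i return 'M[R]_(koszul_rankS j'.+1 i, koszul_rank j'.+1 i) with
      | 0 => col_mx (koszul_diff j' 0) (T j')
      | i'.+1 => block_mx (koszul_diff j' i'.+1) 0
          (koszul_diag (T j') j' i'.+1) (- koszul_diff j' i')
      end
  end.

Lemma koszul_diffS0 j : koszul_diff j.+1 0 = col_mx (koszul_diff j 0) (T j).
Proof. by []. Qed.

Lemma koszul_diffSS j i :
  koszul_diff j.+1 i.+1 =
  block_mx (koszul_diff j i.+1) 0 (koszul_diag (T j) j i.+1) (- koszul_diff j i).
Proof. by []. Qed.

Lemma koszul_diagSS X j i :
  koszul_diag X j.+1 i.+1 = block_mx (koszul_diag X j i.+1) 0 0 (koszul_diag X j i).
Proof. by case: i. Qed.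

Lemma koszul_diagM X Y j i : koszul_diag X j i *m koszul_diag Y j i = koszul_diag (X *m Y) j i.
Proof.
elim: j i => [|j IHj] [|i] //; first by apply/matrixP; case.
rewrite !koszul_diagSS.
rewrite (@mulmx_block _ (koszul_rank j i.+1) (koszul_rank j i)
  (koszul_rank j i.+1) (koszul_rank j i) (koszul_rank j i.+1)).
by rewrite !(mul0mx, mulmx0, addr0, add0r) !IHj.
Qed.

Lemma koszul_diag_diff X j i : (forall l, X *m T l = T l *m X) ->
  koszul_diag X j i.+1 *m koszul_diff j i = koszul_diff j i *m koszul_diag X j i.
Proof.
move=> XT; elim: j i => [|j IHj] [|i]; do ?by apply/matrixP; case.
  rewrite koszul_diagSS koszul_diffS0 mul_block_col !mul0mx addr0 add0r (IHj 0%N) mul_col_mx.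
  by congr col_mx; apply: XT.
rewrite !koszul_diagSS koszul_diffSS.
rewrite (@mulmx_block _ (koszul_rank j i.+2) (koszul_rank j i.+1)
  (koszul_rank j i.+2) (koszul_rank j i.+1) (koszul_rank j i.+1)).
rewrite (@mulmx_block _ (koszul_rank j i.+2) (koszul_rank j i.+1)
  (koszul_rank j i.+1) (koszul_rank j i) (koszul_rank j i.+1)).
rewrite !(mul0mx, mulmx0, addr0, add0r) !IHj.
by rewrite mulmxN mulNmx IHj !koszul_diagM XT.
Qed.

Lemma koszul_rank_gt j i : (j < i)%N -> koszul_rank j i = 0%N.
Proof.
case: i => // i /=; rewrite ltnS; elim: j i => [|j IHj] i //= ji.
by rewrite IHj ?(ltnW ji) //; case: i ji => // i /IHj ->.
Qed.

Section Exactness.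
Hypothesis TC : forall l m, T l *m T m = T m *m T l.

Lemma koszul_diffK j i : koszul_diff j i.+1 *m koszul_diff j i = 0.
Proof.
elim: j i => [|j IHj] [|i]; do ?by apply/matrixP; case.
  rewrite koszul_diffS0 koszul_diffSS mul_block_col mul0mx addr0 IHj koszul_diag_diff ?mulNmx //.
  by rewrite subrr; apply: col_mx0.
rewrite !koszul_diffSS.
rewrite (@mulmx_block _ (koszul_rank j i.+3) (koszul_rank j i.+2)
  (koszul_rank j i.+2) (koszul_rank j i.+1) (koszul_rank j i.+1)).
rewrite !(mul0mx, mulmx0, addr0, add0r) IHj.
by rewrite !mulNmx mulmxN opprK IHj koszul_diag_diff // subrr block_mx0.
Qed.

Variables (c : nat) (J : nat -> 'rV[R]_r -> Prop).
Hypothesis J0 : forall x, J 0 x <-> x = 0.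
Hypothesis JS : forall j x, (j < c)%N -> J j.+1 x <-> exists w, J j (x - w *m T j).
Hypothesis Jreg : forall j x, (j < c)%N -> J j (x *m T j) -> J j x.

(** [J j] plays the role of the sum of the images of the first j operators, and [Jreg] says that
    they form a regular sequence. It is kept abstract because in the application it is a kernel. The
    induction on j is the long exact sequence of the cone of [T j]. *)
Lemma koszul_exact j : (j <= c)%N ->
  (forall x, J j x <-> exists y : 'rV_(koszul_rank j 1), x = y *m koszul_diff j 0) /\
  (forall i (x : 'rV_(koszul_rank j i.+1)), x *m koszul_diff j i = 0 ->
     exists y : 'rV_(koszul_rank j i.+2), x = y *m koszul_diff j i.+1).
Proof.
elim: j => [_|j IHj jc].
  split=> [x|i x _]; last by exists 0; rewrite mul0mx [LHS]thinmx0.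
  split=> [/J0 ->|[y ->]]; first by exists 0; rewrite mul0mx.
  by apply/J0; rewrite mulmx0.
have [H0 Hi] := IHj (ltnW jc); split.
  move=> x; rewrite JS //; split=> [[w /H0[y /eqP]]|[y ->]].
    rewrite subr_eq => /eqP ->; exists (row_mx y w).
    by rewrite koszul_diffS0 mul_row_col.
  exists (rsubmx y); apply/H0; exists (lsubmx y).
  by rewrite -{1}[y]hsubmxK koszul_diffS0 mul_row_col addrK.
case=> [|i] x.
  rewrite -[x]hsubmxK; move: (lsubmx x) (rsubmx x) => x1 x2 {x}.
  rewrite koszul_diffS0 mul_row_col => /eqP; rewrite addr_eq0 => /eqP x12.
  (* Regularity enters only here: x2 T_j is a boundary, so x2 = z d. Then x1 + z T_j is a cycle,
     hence y d, and (y, -z) bounds (x1, x2). *)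
  have [|z x2E] := (H0 x2).1.
    by apply: Jreg => //; apply/H0; exists (- x1); rewrite mulNmx x12 opprK.
  have [|y yE] := Hi 0%N (x1 + z *m koszul_diag (T j) j 1).
    by rewrite mulmxDl -mulmxA koszul_diag_diff // mulmxA -x2E x12 addNr.
  exists (row_mx y (- z)); rewrite koszul_diffSS mul_row_block -yE !mulNmx mulmxN.
  by rewrite mulmx0 add0r addrK opprK -x2E.
rewrite -[x]hsubmxK; move: (lsubmx x) (rsubmx x) => x1 x2 {x}.
rewrite koszul_diffSS mul_row_block mulmx0 add0r mulmxN => /eqP.
rewrite row_mx_eq0 addr_eq0 oppr_eq0 => /andP[/eqP x12 /eqP /Hi[z x2E]].
have [|y yE] := Hi i.+1 (x1 + z *m koszul_diag (T j) j i.+2).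
  by rewrite mulmxDl -mulmxA koszul_diag_diff // mulmxA -x2E x12 addNr.
exists (row_mx y (- z)); rewrite koszul_diffSS mul_row_block -yE !mulNmx mulmxN.
by rewrite mulmx0 add0r addrK opprK -x2E.
Qed.

End Exactness.

(* The isomorphism of the top term of the complex with R^r, and its inverse. *)
Fixpoint koszul_top (j : nat) : 'M[R]_(r, koszul_rank j j) :=
  match j return 'M[R]_(r, koszul_rank j j) with
  | 0 => 1%:M
  | j'.+1 => row_mx (0 : 'M_(r, koszul_rankS j' j')) (koszul_top j')
  end.

Fixpoint koszul_top_inv (j : nat) : 'M[R]_(koszul_rank j j, r) :=
  match j return 'M[R]_(koszul_rank j j, r) with
  | 0 => 1%:M
  | j'.+1 => col_mx (0 : 'M_(koszul_rankS j' j', r)) (koszul_top_inv j')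
  end.

Lemma koszul_topK j : koszul_top j *m koszul_top_inv j = 1%:M.
Proof.
elim: j => [|j IHj] /=; first by rewrite mulmx1.
by rewrite mul_row_col mul0mx add0r IHj.
Qed.

Lemma koszul_top_diag X j : koszul_top j *m koszul_diag X j j = X *m koszul_top j.
Proof.
elim: j => [|j IHj]; first by rewrite /= mul1mx mulmx1.
by rewrite koszul_diagSS mul_row_block !(mul0mx, mulmx0, addr0, add0r) IHj mul_mx_row mulmx0.
Qed.

Definition top_cobounds j : 'cV[R]_(koszul_rank j j) -> Prop :=
  match j return 'cV[R]_(koszul_rank j j) -> Prop with
  | 0 => fun z => z = 0
  | j'.+1 => fun z => exists x, z = koszul_diff j'.+1 j' *m x
  end.

Section TopCohomology.
Variables (c : nat) (J : nat -> 'cV[R]_r -> Prop).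
Hypothesis J0 : forall x, J 0 x <-> x = 0.
Hypothesis JS : forall j x, (j < c)%N -> J j.+1 x <-> exists w, J j (x - T j *m w).

(** Here [J j] is the sum of the images of the first j operators acting on columns. Dualising the
    cone adds the image of [T j] to the coboundaries of the previous top term. *)
Lemma top_coboundsP j z : (j <= c)%N -> @top_cobounds j z <-> J j (koszul_top j *m z).
Proof.
elim: j z => [|j IHj] z jc; first by rewrite /= mul1mx J0.
(* The first summand of the cone in top degree has rank 0, so only the block [z2] carries
   information. *)
have e0 (x y : 'cV[R]_(koszul_rankS j j)) : x = y.
  by apply/matrixP=> -[m hm]; exfalso; move: hm;
    rewrite -[X in (_ < X)%N]/(koszul_rank j j.+1) koszul_rank_gt.
rewrite -[z]vsubmxK; move: (usubmx z) (dsubmx z) => z1 z2 {z}.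
rewrite JS // [koszul_top _.+1]/= mul_row_col mul0mx add0r.
have top_sub (x : 'cV_(koszul_rank j j)) : koszul_top j *m (z2 - koszul_diag (T j) j j *m x) =
    koszul_top j *m z2 - T j *m (koszul_top j *m x).
  by rewrite mulmxBr !mulmxA koszul_top_diag.
transitivity (exists x : 'cV_(koszul_rank j j), top_cobounds (z2 - koszul_diag (T j) j j *m x)).
  case: j jc z1 z2 IHj e0 top_sub => [|j] jc z1 z2 IHj e0 top_sub.
    split=> [[x]|[x /eqP]].
      by rewrite koszul_diffS0 mul_col_mx => /eq_col_mx[_ ->]; exists x; rewrite /= subrr.
    rewrite subr_eq0 => /eqP ->; exists x; rewrite koszul_diffS0 mul_col_mx.
    by congr col_mx; apply: e0.
  split=> [[x]|[x [y /eqP]]].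
    rewrite -[x]vsubmxK; move: (usubmx x) (dsubmx x) => x1 x2 {x}.
    rewrite koszul_diffSS mul_block_col => /eq_col_mx[_ ->]; exists x1, (- x2).
    by rewrite mulmxN mulNmx addrC addKr.
  rewrite subr_eq => /eqP ->; exists (col_mx x (- y)).
  rewrite koszul_diffSS mul_block_col mulNmx !mulmxN opprK [koszul_diag _ _ _ *m x + _]addrC.
  by congr col_mx; apply: e0.
split=> [[x /(IHj _ (ltnW jc))]|[w]]; first by rewrite top_sub; exists (koszul_top j *m x).
move=> Jw; exists (koszul_top_inv j *m w); apply/(IHj _ (ltnW jc)).
by rewrite top_sub [koszul_top j *m (_ *m w)]mulmxA koszul_topK mul1mx.
Qed.

End TopCohomology.
End Koszul.

(** * Grading of the Koszul complex *)

Section KoszulDegrees.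
Variables (K : fieldType) (N r : nat) (a : 'I_r -> int).
Variable T : nat -> 'M[{mpoly K[N]}]_r.

(** Each operator has degree 1, so the copy of the complex added by a cone is shifted by 1. The 0 of
    the base case is a dummy: the basis there is empty. *)
Fixpoint koszul_degS (j : nat) : forall i, 'I_(koszul_rankS r j i) -> int :=
  match j return forall i, 'I_(koszul_rankS r j i) -> int with
  | 0 => fun i b => 0
  | j'.+1 => fun i b => match split b with
      | inl b1 => koszul_degS b1
      | inr b2 => (match i return 'I_(koszul_rank r j' i) -> int with
                   | 0 => a | i'.+1 => @koszul_degS j' i' end) b2 + 1
      end
  end.

Definition koszul_deg j i : 'I_(koszul_rank r j i) -> int :=
  match i return 'I_(koszul_rank r j i) -> int with 0 => a | i'.+1 => @koszul_degS j i' end.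

Lemma koszul_degSS j i b :
  @koszul_deg j.+1 i.+1 b = match split b with inl b1 => @koszul_deg j i.+1 b1
                                       | inr b2 => @koszul_deg j i b2 + 1 end.
Proof. by case: i b. Qed.

Lemma hmatrix_koszul_diag (X : 'M[{mpoly K[N]}]_r) j i : hmatrix (fun b => a b + 1) a X ->
  hmatrix (fun b => @koszul_deg j i b + 1) (@koszul_deg j i) (koszul_diag X j i).
Proof.
move=> hX; elim: j i => [|j IHj] [|i] //; first by case.
move=> b b'; rewrite koszul_diagSS !koszul_degSS !mxE.
case: (split b) => b1; rewrite mxE; case: (split b') => b2; rewrite ?mxE.
- exact: IHj.
- exact: homogeneous0.
- exact: homogeneous0.
by have := IHj i b1 b2; congr homogeneous; lia.
Qed.

Hypothesis hT : forall j, hmatrix (fun b => a b + 1) a (T j).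

Lemma hmatrix_koszul_diff j i : hmatrix (@koszul_deg j i.+1) (@koszul_deg j i) (koszul_diff T j i).
Proof.
elim: j i => [|j IHj] i; first by case.
case: i => [|i] b b'; rewrite ?koszul_diffS0 ?koszul_diffSS !koszul_degSS !mxE.
  case: (split b) => b1; [exact: IHj|exact: (@hT j)].
case: (split b) => b1; rewrite mxE; case: (split b') => b2; rewrite ?mxE.
- exact: IHj.
- exact: homogeneous0.
- by have := @hmatrix_koszul_diag (T j) j i.+1 (@hT j) b1 b2.
by apply: homogeneousN; have := IHj i b1 b2; congr homogeneous; lia.
Qed.

Lemma hmatrix_koszul_top j :
  hmatrix (fun b => a b + j%:Z) (@koszul_deg j j) (koszul_top {mpoly K[N]} r j).
Proof.
elim: j => [|j IHj] b b'.
  rewrite mxE; case: eqP => [->|_]; last exact: homogeneous0.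
  by rewrite addr0 subrr; apply: homogeneous1.
rewrite koszul_degSS mxE; case: (split b') => b1; first by rewrite mxE; apply: homogeneous0.
by have := IHj b b1; congr homogeneous; lia.
Qed.

End KoszulDegrees.

(** * Presentation of the Veronese modules *)

(** The cofactor is u + a w, with a w written as y w - (y - a) w: multiplication by y and by y - a
    lifts to operators on R^r in [eval_diff]. *)
Lemma telescoping_step (A : comNzRingType) (y a u v w : A) :
  u - v = (y - a) * w -> y * u - a * v = (y - a) * (u + y * w - (y - a) * w).
Proof.
move=> uv; have -> : v = u - (y - a) * w by rewrite -uv subKr.
by ring.
Qed.

Lemma telescoping_add (A : comNzRingType) (y u v w u' v' w' : A) :
  u - v = y * w -> u' - v' = y * w' -> u + u' - (v + v') = y * (w + w').
Proof. by move=> uv uv'; rewrite mulrDr -uv -uv'; ring. Qed.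

Lemma telescoping_mul (A : comNzRingType) (y c u v w : A) :
  u - v = y * w -> c * u - c * v = y * (c * w).
Proof. by move=> uv; rewrite mulrCA -uv mulrBr. Qed.

Lemma row_mpoly_ind (K : fieldType) N r (P : 'rV[{mpoly K[N]}]_r -> Prop) :
    P 0 -> (forall x y, P x -> P y -> P (x + y)) ->
    (forall c x, P x -> P (c%:MP *: x)) -> (forall i x, P x -> P ('X_i *: x)) ->
    (forall b, P (delta_mx 0 b)) ->
  forall x, P x.
Proof.
move=> P0 PD PC PX Pd x; rewrite [x]row_sum_delta.
elim/big_ind: _ => // b _; rewrite [x 0 b]mpolyE scaler_suml.
elim/big_ind: _ => // m _; rewrite -mul_mpolyC -scalerA; apply: PC.
suff: forall y, P y -> P ('X_[m] *: y) by apply.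
rewrite mpolyXE_id.
apply: (@big_ind _ (fun f => forall y, P y -> P (f *: y))) => [y|f g Pf Pg y Py|i _ y Py].
- by rewrite scale1r.
- by rewrite -scalerA; apply/Pf/Pg.
elim: (m i) => [|q IHq]; first by rewrite expr0 scale1r.
by rewrite exprS -scalerA; apply: PX.
Qed.

Section Presentation.
Variables (K : fieldType) (n d : nat) (e : monomial_enum n d).
HB.instance Definition _ := GRing.LRMorphism.copy (@veronese_map K n d e)
  (comp_mpoly [tuple 'X_[tnth e i] | i < 'C((n + d).-1, d)]).
Hypothesis d_gt0 : (0 < d)%N.
Local Notation N := 'C((n + d).-1, d).
Local Notation R := {mpoly K[N]}.

Variable pi : 'I_n -> 'I_N.
Hypothesis piE : forall j, tnth e (pi j) = (U_(j) *+ d)%MM.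

Lemma pi_inj : injective pi.
Proof.
move=> i j /(congr1 (tnth e)); rewrite !piE => /mnmP/(_ i).
rewrite !mulmnE !mnm1E eqxx mul1n; case: eqP => // _ d0.
by move: d_gt0; rewrite d0.
Qed.

Lemma mdeg_enum i : mdeg (tnth e i) = d.
Proof. by have := mem_tnth i e; rewrite monomials_mem inE => /eqP. Qed.

(* K[x_1, ..., x_n, y_1, ..., y_N]. *)
Definition ambient : idomainType := {mpoly K[n + N]}.
Local Notation Q := ambient.

Definition amb_poly : {mpoly K[n]} -> Q :=
  mmap (@mpolyC (n + N) K) (fun j => 'X_(lshift N j)).
HB.instance Definition _ := GRing.RMorphism.on amb_poly.

Definition amb_var (i : 'I_N) : Q := 'X_(rshift n i) : {mpoly K[n + N]}.

Definition amb_mnm (a : 'X_{1..n}) (m : 'X_{1..N}) : 'X_{1..n + N} :=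
  [multinom match split i with inl j => a j | inr l => m l end | i < n + N].

Definition amb_coef a m (f : Q) : K := (f : {mpoly K[n + N]})@_(amb_mnm a m).
HB.instance Definition _ a m :=
  GRing.Additive.copy (amb_coef a m) (@mcoeff (n + N) K (amb_mnm a m)).

Lemma amb_mnmE (a : 'X_{1..n}) (m : 'X_{1..N}) : amb_poly 'X_[a] * \prod_i amb_var i ^+ m i =
  'X_[amb_mnm a m] :> {mpoly K[n + N]}.
Proof.
rewrite [RHS]mpolyXE_id big_split_ord /amb_poly mmapX /mmap1; congr (_ * _).
  by apply: eq_bigr => j _; rewrite mnmE (unsplitK (inl j)).
by apply: eq_bigr => l _; rewrite mnmE (unsplitK (inr l)).
Qed.

Lemma amb_coefE (a a' : 'X_{1..n}) (m m' : 'X_{1..N}) :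
  amb_coef a m (amb_poly 'X_[a'] * \prod_i amb_var i ^+ m' i) =
  ((a' == a) && (m' == m))%:R.
Proof.
rewrite amb_mnmE /amb_coef mcoeffX; congr ((nat_of_bool _)%:R).
apply/eqP/andP => [am|[/eqP -> /eqP -> //]].
split; apply/eqP/mnmP => i; move/mnmP: am.
  by move/(_ (lshift N i)); rewrite !mnmE (unsplitK (inl i)).
by move/(_ (rshift n i)); rewrite !mnmE (unsplitK (inr i)).
Qed.

Lemma amb_coefZ a m c f : amb_coef a m (amb_poly c%:MP * f) = c * amb_coef a m f.
Proof. by rewrite /amb_poly mmapC /amb_coef mcoeffCM. Qed.

Lemma amb_poly_inj : injective amb_poly.
Proof.
move=> f g fg; apply/mpolyP => a.
suff cE h : amb_coef a 0%MM (amb_poly h) = h@_a by rewrite -!cE fg.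
elim/mpolyind: h => [|c u h _ _ IHh]; first by rewrite !raddf0.
rewrite rmorphD !raddfD /= IHh; congr (_ + _).
rewrite -mul_mpolyC rmorphM amb_coefZ mcoeffCM mcoeffX; congr (_ * _).
pose m0 : 'X_{1..N} := 0%MM.
transitivity (amb_coef a m0 (amb_poly 'X_[u] * \prod_i amb_var i ^+ m0 i)).
  by rewrite big1 ?mulr1 // => i _; rewrite mnm0E expr0.
by rewrite amb_coefE eqxx andbT.
Qed.

Lemma amb_endo l (y : Q) : exists g : {rmorphism Q -> Q},
  (forall f, g (amb_poly f) = amb_poly f) /\
  forall i, g (amb_var i) = if i == l then y else amb_var i.
Proof.
pose h (i : 'I_(n + N)) : Q := match split i with
  | inl j => 'X_(lshift N j) : {mpoly K[n + N]}
  | inr i => if i == l then y else amb_var i end.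
pose g : {rmorphism Q -> Q} := mmap (@mpolyC (n + N) K) h.
exists g; split=> [f|i]; last by rewrite /g /= mmapX mmap1U /h (unsplitK (inr i)).
rewrite /amb_poly /mmap rmorph_sum; apply: eq_bigr => m _.
rewrite rmorphM {1}/g /= mmapC; congr (_ * _); rewrite /mmap1 rmorph_prod.
apply: eq_bigr => j _; rewrite rmorphXn; congr (_ ^+ _).
by rewrite /g /= mmapX mmap1U /h (unsplitK (inl j)).
Qed.

Lemma amb_var_neq l f : amb_var l - amb_poly f != 0.
Proof.
(* If y_l - f were 0, the substitution y_l := y_l + 1 would give 1 = 0. *)
have [g [gC gX]] := amb_endo l (amb_var l + 1).
apply/eqP => l0; have := congr1 g l0; rewrite rmorphB gC gX eqxx rmorph0 addrAC l0.
by rewrite add0r => /eqP; rewrite oner_eq0.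
Qed.

Section Substitution.
Variable s : {set 'I_N}.

Definition subst_var (i : 'I_N) : Q :=
  if i \in s then amb_poly 'X_[tnth e i] else amb_var i.

Definition subst : R -> Q := mmap (amb_poly \o @mpolyC n K) subst_var.
HB.instance Definition _ := GRing.RMorphism.on subst.

Lemma substC c : subst c%:MP = amb_poly c%:MP.
Proof. by rewrite /subst mmapC. Qed.

Lemma substX i : subst 'X_i = subst_var i.
Proof. by rewrite /subst mmapX mmap1U. Qed.

End Substitution.

Lemma subst_setT f : subst setT f = amb_poly (veronese_map e f).
Proof.
rewrite /subst /veronese_map /comp_mpoly /mmap rmorph_sum; apply: eq_bigr => m _.
rewrite rmorphM /mmap1 rmorph_prod /=; congr (_ * _); apply: eq_bigr => i _.
by rewrite rmorphXn /= /subst_var inE tnth_mktuple.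
Qed.

Lemma veronese_mapX m :
  veronese_map e ('X_[m] : R) = 'X_[(\sum_i tnth e i *+ m i)%MM].
Proof.
rewrite /veronese_map /comp_mpoly mmapX /mmap1 -mprodXnE.
by apply: eq_bigr => i _; rewrite tnth_mktuple.
Qed.

Lemma veronese_map_hproj j f :
  hproj (j * d%:Z) (veronese_map e f) = veronese_map e (hproj j (f : R)).
Proof.
elim/mpolyind: f => [|c m f _ _ IHf]; first by rewrite !linear0.
rewrite !linearD /= IHf; congr (_ + _).
rewrite !linearZ /= !hprojX veronese_mapX hprojX mdeg_sum; congr (_ *: _).
rewrite (eq_bigr (fun i => m i * d)%N) => [|i _]; last by rewrite mdegMn mdeg_enum mulnC.
rewrite -big_distrl -mdegE /= PoszM.
rewrite (inj_eq (mulIf _)) ?pnatr_eq0 -?lt0n // ?eqz_nat -?lt0n //.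
case: ifP => _; first by rewrite veronese_mapX.
by rewrite linear0.
Qed.

Definition mnm_mod (a : 'X_{1..n}) : 'X_{1..n} := [multinom (a j %% d)%N | j < n].

(** The quotient in the division of x^a by the pure powers x_j^d, lifted to a monomial in the pure
    variables; [mnm_mod] is the remainder. *)
Definition mnm_lift (a : 'X_{1..n}) : 'X_{1..N} := (\sum_j U_(pi j) *+ (a j %/ d)%N)%MM.

Lemma mnm_liftE a : (\sum_i tnth e i *+ mnm_lift a i + mnm_mod a)%MM = a.
Proof.
apply/mnmP => j; rewrite mnmDE mnm_sumE mnmE {2}(divn_eq (a j) d); congr addn.
under eq_bigr => i _ do rewrite mulmnE /mnm_lift mnm_sumE big_distrr /=.
rewrite exchange_big (bigD1 j) //= (bigD1 (pi j)) //= piE !mulmnE !mnm1E !eqxx !mul1n mulnC.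
rewrite big1 ?addn0 => [|i ij]; last by rewrite mulmnE mnm1E eq_sym (negPf ij) muln0.
rewrite big1 ?addn0 // => l lj; rewrite big1 // => i _; rewrite mulmnE mnm1E.
case: eqP => [<-|]; last by rewrite muln0.
by rewrite piE mulmnE mnm1E (negPf lj).
Qed.

Lemma mdeg_mnm_lift a : (d * mdeg (mnm_lift a) + mdeg (mnm_mod a))%N = mdeg a.
Proof.
rewrite -{3}[a]mnm_liftE mdegD mdeg_sum; congr addn.
rewrite (eq_bigr (fun i => d * mnm_lift a i)%N) => [|i _].
  by rewrite -big_distrr -mdegE.
by rewrite mdegMn mdeg_enum.
Qed.

Lemma subst_lift (s : {set 'I_N}) a : (forall j, pi j \in s) ->
  subst s 'X_[mnm_lift a] * amb_poly 'X_[mnm_mod a] = amb_poly 'X_[a].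
Proof.
move=> pis; suff ->: subst s 'X_[mnm_lift a] = subst setT 'X_[mnm_lift a].
  by rewrite subst_setT veronese_mapX -rmorphM -mpolyXD mnm_liftE.
rewrite /mnm_lift -mprodXE !rmorph_prod; apply: eq_bigr => j _.
by rewrite -mpolyXn [LHS]rmorphXn [RHS]rmorphXn /= !substX /subst_var pis inE.
Qed.

Section Basis.
Variables (r : nat) (beta : 'I_r -> 'X_{1..n}).
Hypothesis beta_inj : injective beta.
Hypothesis beta_lt : forall b j, (beta b j < d)%N.
(* Multiplying x^(beta b) by a monomial of degree d stays in the span over    *)
(* K[x_1^d, ..., x_n^d] of the x^(beta b).                                    *)
Hypothesis beta_closed : forall b l, exists b', beta b' = mnm_mod (tnth e l + beta b).

(** The operator T_l: row b is y_l e_b minus the expansion of x^(e_l) x^(beta b) obtained by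
    dividing its exponent by d. *)
Definition relation_mx (l : 'I_N) : 'M[R]_r := \matrix_(b, b')
  ((b == b')%:R * 'X_l -
   (beta b' == mnm_mod (tnth e l + beta b))%:R * 'X_[mnm_lift (tnth e l + beta b)]).

Section Evaluation.
Variable s : {set 'I_N}.

(** The augmentation with only the variables in [s] replaced by their monomials. It interpolates
    between an injective map ([s] the pure variables) and the augmentation itself ([s]
    everything). *)
Definition eval (v : 'rV[R]_r) : Q := \sum_b subst s (v 0 b) * amb_poly 'X_[beta b].

Lemma evalP c v w : eval (c *: v + w) = subst s c * eval v + eval w.
Proof.
rewrite /eval [X in _ = X + _]mulr_sumr -big_split.
apply: eq_bigr => b _.
rewrite !mxE [subst s _]rmorphD [X in (X + _) * _]rmorphM mulrDl.
by congr (_ + _); rewrite -mulrA.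
Qed.

Fact eval_is_linear : linear_for (subst s \; *%R) eval.
Proof. exact: evalP. Qed.
HB.instance Definition _ :=
  GRing.isLinear.Build R 'rV[R]_r Q (subst s \; *%R) eval eval_is_linear.

Lemma evalZ c v : eval (c *: v) = subst s c * eval v.
Proof. exact: linearZ. Qed.

Lemma evalD v w : eval (v + w) = eval v + eval w.
Proof. exact: linearD. Qed.

Lemma evalB v w : eval (v - w) = eval v - eval w.
Proof. exact: linearB. Qed.

Lemma eval0 : eval 0 = 0.
Proof. exact: linear0. Qed.

Lemma eval_delta b : eval (delta_mx 0 b) = amb_poly 'X_[beta b].
Proof.
rewrite /eval (bigD1 b) //= mxE !eqxx rmorph1 mul1r big1 ?addr0 // => i ib.
by rewrite mxE (negPf ib) andbF rmorph0 mul0r.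
Qed.

Hypothesis pis : forall j, pi j \in s.

(** The operator T_l turns into a scalar of the domain [Q], which is 0 for l in [s] and y_l -
    x^(e_l) otherwise. *)
Lemma eval_relation v l : eval (v *m relation_mx l) =
  (subst s 'X_l - amb_poly 'X_[tnth e l]) * eval v.
Proof.
rewrite {1}[v]row_sum_delta mulmx_suml linear_sum /eval mulr_sumr.
apply: eq_bigr => b _; rewrite -scalemxAl linearZ /= mulrCA; congr (_ * _).
have [b' b'E] := beta_closed b l.
rewrite -rowE /eval (eq_bigr (fun i => subst s ((b == i)%:R * 'X_l) * amb_poly 'X_[beta i] -
   (i == b')%:R * amb_poly 'X_[(tnth e l + beta b)%MM])) => [|i _].
  rewrite sumrB (bigD1 b) //= eqxx mul1r big1 ?addr0 => [|i ib]; last first.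
    by rewrite eq_sym (negPf ib) mul0r rmorph0 mul0r.
  rewrite (bigD1 b') //= eqxx mul1r big1 ?addr0 => [|i ib]; last by rewrite (negPf ib) mul0r.
  by rewrite mpolyXD rmorphM mulrBl.
rewrite !mxE rmorphB mulrBl -b'E (inj_eq beta_inj); congr (_ - _).
case: eqP => [->|_]; last by rewrite !mul0r rmorph0 mul0r.
by rewrite !mul1r b'E subst_lift.
Qed.

End Evaluation.

(** Divisibility by y_l - x^(e_l) is clear; the point is that the quotient is again a value of
    [eval s]. This is built up by induction on [v]. *)
Lemma eval_diff (s : {set 'I_N}) l v : (forall j, pi j \in s) -> l \notin s ->
  exists w, eval s v - eval (l |: s) v = (amb_var l - amb_poly 'X_[tnth e l]) * eval s w.
Proof.
move=> pis ls; elim/row_mpoly_ind: v => [|x y [w wE] [w' w'E]|c x [w wE]|i x [w wE]|b].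
- by exists 0; rewrite !eval0 subr0 mulr0.
- exists (w + w').
  rewrite !evalD.
  exact: (telescoping_add wE w'E).
- by exists (c%:MP *: w); rewrite !evalZ !substC; apply: telescoping_mul.
- have [->|il] := eqVneq i l.
    (* The factor x^(e_l) acts on [w] as y_l - T_l, by [eval_relation]. *)
    exists (x + 'X_l *: w - w *m relation_mx l).
    rewrite evalB evalD !evalZ eval_relation // !substX /subst_var.
    by rewrite setU11 (negPf ls); apply: telescoping_step.
  exists ('X_i *: w); rewrite !evalZ !substX /subst_var in_setU1 (negPf il) /=.
  exact: telescoping_mul.
by exists 0; rewrite !eval_delta subrr eval0 mulr0.
Qed.

(** [eval (l |: s)] is [eval s] followed by the substitution y_l := x^(e_l). *)
Lemma eval_setU1 (s : {set 'I_N}) l v : l \notin s -> eval s v = 0 -> eval (l |: s) v = 0.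
Proof.
move=> ls; have [g [gC gX]] := amb_endo l (amb_poly 'X_[tnth e l]).
suff gE : g (eval s v) = eval (l |: s) v by move=> v0; rewrite -gE v0 rmorph0.
rewrite /eval rmorph_sum; apply: eq_bigr => b _; rewrite rmorphM gC; congr (_ * _).
rewrite /subst /mmap rmorph_sum; apply: eq_bigr => m _; rewrite rmorphM gC.
congr (_ * _); rewrite /mmap1 rmorph_prod; apply: eq_bigr => i _.
rewrite rmorphXn /subst_var in_setU1; congr (_ ^+ _).
by have [is_|is_] := boolP (i \in s); rewrite ?orbT ?gC // orbF gX; case: eqP => // ->.
Qed.

(** Eliminating y_l enlarges the kernel by exactly the image of T_l: if the new value vanishes,
    [eval_diff] writes the old one as [eval s] of some w T_l. *)
Lemma eval_setU1P (s : {set 'I_N}) l v : (forall j, pi j \in s) -> l \notin s ->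
  eval (l |: s) v = 0 <-> exists w, eval s (v - w *m relation_mx l) = 0.
Proof.
move=> pis ls; split=> [v0|[w]].
  have [w wE] := eval_diff v pis ls; exists w.
  rewrite evalB eval_relation // substX /subst_var (negPf ls) -wE v0.
  by rewrite subr0 subrr.
move/(eval_setU1 ls); rewrite evalB eval_relation => [|j].
  by rewrite substX /subst_var setU11 subrr mul0r subr0.
by rewrite in_setU1 pis orbT.
Qed.

Lemma eval_regular (s : {set 'I_N}) l v : (forall j, pi j \in s) -> l \notin s ->
  eval s (v *m relation_mx l) = 0 -> eval s v = 0.
Proof.
move=> pis ls; rewrite eval_relation // substX /subst_var (negPf ls) => /eqP.
by rewrite mulf_eq0 (negPf (amb_var_neq _ _)) => /eqP.
Qed.

Definition pures : {set 'I_N} := [set pi j | j : 'I_n].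

Lemma mem_pures j : pi j \in pures.
Proof. exact: imset_f. Qed.

Definition mnm_pure (m : 'X_{1..N}) : 'X_{1..n} := [multinom (m (pi j) * d)%N | j < n].
Definition mnm_nonpure (m : 'X_{1..N}) : 'X_{1..N} :=
  [multinom if i \in pures then 0%N else m i | i < N].

Lemma subst_puresX m : subst pures 'X_[m] =
  amb_poly 'X_[mnm_pure m] * \prod_i amb_var i ^+ mnm_nonpure m i.
Proof.
rewrite /subst mmapX /mmap1 (bigID (mem pures)) /=; congr (_ * _); last first.
  rewrite [RHS](bigID (mem pures)) /= [X in _ = X * _]big1 ?mul1r => [|i si].
    apply: eq_bigr => i si.
    by rewrite mnmE /subst_var (negPf si).
  by rewrite mnmE si expr0.
rewrite big_imset /=; last by move=> i j _ _; apply: pi_inj.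
rewrite [mnm_pure m]multinomUE_id -mprodXE rmorph_prod; apply: eq_bigr => j _.
rewrite /subst_var mem_pures piE -rmorphXn mpolyXn; congr (amb_poly 'X_[_]).
by apply/mnmP=> i; rewrite !mulmnE !mnmE mulnAC -mulnA.
Qed.

(** Exponents of [beta] are below d, so division by d separates [beta b] (remainder) from the pure
    part of [m] (quotient). *)
Lemma mnm_pure_inj b b0 m m0 : (mnm_pure m + beta b = mnm_pure m0 + beta b0)%MM ->
  mnm_nonpure m = mnm_nonpure m0 -> b = b0 /\ m = m0.
Proof.
move=> eq_pure eq_nonpure.
have eq_beta j : beta b j = beta b0 j.
  move/mnmP/(_ j): eq_pure; rewrite !mnmDE !mnmE => /(congr1 (modn^~ d)).
  by rewrite !modnMDl !modn_small.
split; first by apply/beta_inj/mnmP.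
apply/mnmP => i; have [/imsetP[j _ ->]|si] := boolP (i \in pures).
  move/mnmP/(_ j): eq_pure; rewrite !mnmDE !mnmE eq_beta => /addIn /eqP.
  by rewrite eqn_pmul2r // => /eqP.
by move/mnmP/(_ i): eq_nonpure; rewrite !mnmE (negPf si).
Qed.

Lemma eval_coef b0 m0 f b :
  amb_coef (mnm_pure m0 + beta b0) (mnm_nonpure m0)
    (subst pures f * amb_poly 'X_[beta b]) = (b == b0)%:R * f@_m0.
Proof.
elim/mpolyind: f => [|c m f _ _ IHf].
  by rewrite rmorph0 mul0r !raddf0 mulr0.
rewrite rmorphD mulrDl !raddfD /= mulrDr IHf; congr (_ + _).
rewrite -mul_mpolyC rmorphM /= substC -mulrA amb_coefZ mcoeffCM mulrCA; congr (_ * _).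
rewrite subst_puresX mulrAC -rmorphM -mpolyXD amb_coefE mcoeffX -natrM mulnb.
congr ((nat_of_bool _)%:R); apply/andP/andP => -[/eqP p1 /eqP p2].
  by have [-> ->] := mnm_pure_inj p1 p2.
by rewrite p1 p2.
Qed.

Lemma eval_inj v : eval pures v = 0 -> v = 0.
Proof.
move=> v0; apply/rowP => b0; rewrite mxE; apply/mpolyP => m0; rewrite mcoeff0.
have := raddf0 (amb_coef (mnm_pure m0 + beta b0) (mnm_nonpure m0)).
rewrite -v0 /eval raddf_sum (eq_bigr _ (fun b _ => eval_coef b0 m0 (v 0 b) b)).
by rewrite (bigD1 b0) //= eqxx mul1r big1 ?addr0 // => b /negPf ->; rewrite mul0r.
Qed.

(** The injective map [eval pures] turns both operators into scalar multiplications. *)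
Lemma relation_mxC l m : relation_mx l *m relation_mx m = relation_mx m *m relation_mx l.
Proof.
apply/row_matrixP => b; rewrite !rowE; apply/eqP; rewrite -subr_eq0; apply/eqP/eval_inj.
by rewrite evalB !mulmxA !(eval_relation mem_pures) mulrCA subrr.
Qed.

End Basis.

(* If e_l + beta b = q d + beta b', then also e_l + gamma b' = q d + gamma b. *)
Lemma relation_mx_tr r (beta gamma : 'I_r -> 'X_{1..n}) l :
  (forall b j, beta b j + gamma b j = d.-1)%N ->
  relation_mx gamma l = (relation_mx beta l)^T.
Proof.
(* Stated for arbitrary families so that it also applies with [beta] and [gamma] exchanged: the two
   matrix entries then have the same support. *)
move=> bg; have step (beta' gamma' : 'I_r -> 'X_{1..n}) b b' :
    (forall b j, beta' b j + gamma' b j = d.-1)%N ->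
    beta' b = mnm_mod (tnth e l + beta' b') ->
    gamma' b' = mnm_mod (tnth e l + gamma' b) /\
    mnm_lift (tnth e l + gamma' b) = mnm_lift (tnth e l + beta' b').
  move=> bg' /mnmP bE.
  suff H j : (tnth e l j + gamma' b j = ((tnth e l j + beta' b' j) %/ d) * d + gamma' b' j)%N.
    have lt j : (gamma' b' j < d)%N by have := bg' b' j; lia.
    split; first by apply/mnmP => j; rewrite mnmE mnmDE H modnMDl modn_small.
    rewrite /mnm_lift; apply: eq_bigr => j _; congr (_ *+ _)%MM.
    by rewrite !mnmDE H divnMDl // (divn_small (lt j)) addn0.
  have := divn_eq (tnth e l j + beta' b' j) d.
  by have := bE j; rewrite mnmE mnmDE => <-; have := bg' b j; have := bg' b' j; lia.
apply/matrixP => b b'; rewrite !mxE eq_sym; congr (_ - _).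
have gb i j : (gamma i j + beta i j = d.-1)%N by rewrite addnC.
case: eqP => [gE|gN]; case: eqP => [bE|bN] //.
- by have [_ ->] := step _ _ _ _ bg bE.
- by have [] := bN (step _ _ _ _ gb gE).1.
- by have [] := gN (step _ _ _ _ bg bE).1.
by rewrite !mul0r.
Qed.

End Presentation.

(** * Elimination order, monomial generators and augmentation *)

Section Augmentation.
Variables (K : fieldType) (n d : nat) (e : monomial_enum n d).
Hypothesis d_gt0 : (0 < d)%N.
Local Notation N := 'C((n + d).-1, d).
Local Notation R := {mpoly K[N]}.

Section Grading.
Variables (k : nat).

Lemma veronese_hproj r (a : 'I_r -> int) (g : {linear 'rV[R]_r -> veronese K e k})
    (j : int) (y : 'rV[R]_r) :
    (forall b, veronese_deg (a b) (g (delta_mx 0 b))) ->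
  veronese_val (g (\row_b hproj (j - a b) (y 0 b))) =
  hproj (k%:Z + j * d%:Z) (veronese_val (g y)).
Proof.
move=> ga; have gE x : g x = \sum_b x 0 b *: g (delta_mx 0 b) := row_comb_lin (fun=> erefl) x.
have vS (F : 'I_r -> veronese K e k) :
    veronese_val (\sum_b F b) = \sum_b veronese_val (F b).
  exact: (raddf_sum (val : veronese K e k -> {mpoly K[n]})).
rewrite (gE y) gE !vS linear_sum; apply: eq_bigr => b _; rewrite mxE.
rewrite -[veronese_val (_ *: _)]/(veronese_map e _ * veronese_val (g (delta_mx 0 b))).
rewrite -[veronese_val (_ *: _)]/(veronese_map e (y 0 b) * veronese_val (g (delta_mx 0 b))).
rewrite -veronese_map_hproj // ![_ * veronese_val _]mulrC -(hprojM _ _ (ga b)).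
by congr (hproj _ (_ * _)); lia.
Qed.

End Grading.

Variables (pi : 'I_n -> 'I_N) (i0 : 'I_N).
Hypothesis piE : forall j, tnth e (pi j) = (U_(j) *+ d)%MM.

Definition nonpures : seq 'I_N := enum (~: pures pi).
Definition nonpure j : 'I_N := nth i0 nonpures j.
Definition eliminated j : {set 'I_N} := pures pi :|: [set i in take j nonpures].

Lemma eliminated0 : eliminated 0 = pures pi.
Proof. by apply/setP => i; rewrite !inE take0 orbF. Qed.

Lemma eliminatedS j : (j < size nonpures)%N ->
  eliminated j.+1 = nonpure j |: eliminated j.
Proof.
move=> jc; apply/setP => i; rewrite !inE (take_nth i0) // mem_rcons inE.
by rewrite orbCA.
Qed.

Lemma eliminated_size : eliminated (size nonpures) = setT.
Proof. by apply/setP => i; rewrite !inE take_size mem_enum inE orbN. Qed.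

Lemma nonpure_notin j : (j < size nonpures)%N -> nonpure j \notin eliminated j.
Proof.
move=> jc; have u : uniq nonpures by apply: enum_uniq.
have : nonpure j \in nonpures by rewrite mem_nth.
rewrite mem_enum !inE negb_or => -> /=.
move: u; rewrite -{1}(cat_take_drop j nonpures) (drop_nth i0) // cat_uniq /=.
by case/and3P=> _; rewrite negb_or => /andP[].
Qed.

Lemma pi_eliminated j i : pi i \in eliminated j.
Proof. by rewrite inE mem_pures. Qed.

Definition residue_basis k r (beta : 'I_r -> 'X_{1..n}) :=
  [/\ injective beta, forall b j, (beta b j < d)%N,
      forall b, mdeg (beta b) = k %[mod d] &
      forall a : 'X_{1..n}, (forall j, (a j < d)%N) -> mdeg a = k %[mod d] ->
        exists b, beta b = a].

Lemma residue_basis_exists k :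
  exists r (beta : 'I_r -> 'X_{1..n}), residue_basis k beta.
Proof.
pose A := [set f : {ffun 'I_n -> 'I_d} | (\sum_j f j)%N == k %[mod d]].
pose mnm (f : {ffun 'I_n -> 'I_d}) : 'X_{1..n} := [multinom (f j : nat) | j < n].
have mnm_deg f : mdeg (mnm f) = (\sum_j f j)%N.
  by rewrite mdegE; apply: eq_bigr => j _; rewrite mnmE.
exists #|A|, (fun b => mnm (enum_val b)); split=> [b b' /mnmP bb'|b j|b|a a_lt a_deg].
- apply: enum_val_inj; apply/ffunP => j; apply: val_inj.
  by have := bb' j; rewrite !mnmE.
- by rewrite mnmE.
- by have := enum_valP b; rewrite inE mnm_deg => /eqP.
have mnmK : mnm [ffun j => Ordinal (a_lt j)] = a by apply/mnmP => j; rewrite mnmE ffunE.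
have aA : [ffun j => Ordinal (a_lt j)] \in A by rewrite inE -mnm_deg mnmK a_deg.
by exists (enum_rank_in aA [ffun j => Ordinal (a_lt j)]); rewrite enum_rankK_in.
Qed.

(** A monomial and its complement have total degree n(d-1), so the residues k and t are
    exchanged. *)
Lemma residue_basis_compl k t r (beta : 'I_r -> 'X_{1..n}) :
  (n * d.-1 = k + t %[mod d])%N -> residue_basis k beta ->
  residue_basis t (fun b => [multinom (d.-1 - beta b j)%N | j < n]).
Proof.
move=> kt [binj blt bdeg bsurj].
have deg_compl (a : 'X_{1..n}) : (forall j, (a j < d)%N) ->
    (mdeg a + mdeg [multinom (d.-1 - a j)%N | j < n])%N = (n * d.-1)%N.
  move=> a_lt; rewrite -mdegD mdegE (eq_bigr (fun=> d.-1)) ?sum_nat_const ?card_ord // => j _.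
  by rewrite mnmDE mnmE; have := a_lt j; lia.
split=> [b b' /mnmP bb'|b j|b|a a_lt a_deg].
- apply: binj; apply/mnmP => j; have := bb' j; rewrite !mnmE.
  by have := blt b j; have := blt b' j; lia.
- by rewrite mnmE; lia.
- apply/eqP; rewrite -(eqn_modDl (mdeg (beta b))) deg_compl // kt.
  by rewrite eqn_modDr; apply/eqP/esym.
have [||b bE] := bsurj [multinom (d.-1 - a j)%N | j < n]; first by move=> j; rewrite mnmE; lia.
  apply/eqP; rewrite -(eqn_modDl (mdeg a)) deg_compl // kt addnC eqn_modDr.
  by apply/eqP/esym.
exists b; apply/mnmP => j; rewrite mnmE bE mnmE; have := a_lt j; lia.
Qed.

Section Resolution.
Variables (k r : nat) (beta : 'I_r -> 'X_{1..n}).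
Hypotheses (k_lt : (k < d)%N) (basis : residue_basis k beta).

Lemma residue_basis_closed b l : exists b', beta b' = mnm_mod d (tnth e l + beta b).
Proof.
have [_ _ bdeg bsurj] := basis; apply: bsurj => [j|]; first by rewrite mnmE ltn_pmod.
have := mdeg_mnm_lift piE (tnth e l + beta b)%MM.
by rewrite mdegD mdeg_enum => /(congr1 (modn^~ d)); rewrite mulnC modnMDl modnDl bdeg.
Qed.

(** The degree i of x^(beta b) in S_(n,d,k), where S_(k + i d) has degree i: the quotient by d,
    because k < d. *)
Definition basis_deg b : int := (mdeg (beta b) %/ d)%N.

Lemma basis_degE b : (mdeg (beta b))%:Z = k%:Z + basis_deg b * d%:Z.
Proof.
have [_ _ bdeg _] := basis; rewrite /basis_deg.
by have := divn_eq (mdeg (beta b)) d; rewrite bdeg modn_small //; lia.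
Qed.

Lemma basis_mem b : 'X_[beta b] \in @veronese_pred K n d k.
Proof.
apply/veronese_predP => m; rewrite msuppX inE => /eqP ->.
by exists (mdeg (beta b) %/ d)%N; have := basis_degE b; rewrite /basis_deg; lia.
Qed.

Definition basis_elt b : veronese K e k := Veronese (basis_mem b).

Definition augmentation : {linear 'rV[R]_r -> veronese K e k} := row_comb basis_elt.

Lemma augmentationE v : veronese_val (augmentation v) =
  \sum_b veronese_map e (v 0 b) * 'X_[beta b].
Proof. exact: (raddf_sum (val : veronese K e k -> {mpoly K[n]})). Qed.

Lemma augmentation_surj y : exists v, augmentation v = y.
Proof.
suff [v vE]: exists v, veronese_val (augmentation v) = veronese_val y.
  by exists v; apply: val_inj.
have vD v w : veronese_val (augmentation (v + w)) =
    veronese_val (augmentation v) + veronese_val (augmentation w) by rewrite linearD.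
have [_ _ _ bsurj] := basis; have /veronese_predP hy := veronese_valP y.
rewrite [veronese_val y]mpolyE big_seq.
elim/big_ind: _ => [|f g [v <-] [w <-]|m /hy[i mE]]; first by exists 0; rewrite linear0.
  by exists (v + w); rewrite vD.
have [j||b bE] := bsurj (mnm_mod d m); first by rewrite mnmE ltn_pmod.
  by rewrite -(modnMDl (mdeg (mnm_lift pi m))) mulnC (mdeg_mnm_lift piE) mE addnC modnMDl.
exists ((veronese_val y)@_m *: 'X_[mnm_lift pi m] *: delta_mx 0 b).
rewrite linearZ /= -[row_comb _ _]/(augmentation _) /augmentation /= row_comb_delta.
rewrite -[LHS]/(veronese_map e _ * 'X_[beta b]) linearZ /= veronese_mapX bE.
by rewrite -scalerAl -mpolyXD (mnm_liftE piE).
Qed.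

Lemma augmentation_deg b : veronese_deg (basis_deg b) (augmentation (delta_mx 0 b)).
Proof.
rewrite /veronese_deg /augmentation /= row_comb_delta /= -basis_degE.
exact: homogeneousX.
Qed.

Definition relation j : 'M[R]_r := relation_mx K e pi beta (nonpure j).

(** The predicate [J j] of [koszul_exact], as a kernel: the submodule generated by the images of the
    first j operators. *)
Definition eliminates j (v : 'rV[R]_r) : Prop := eval e beta (eliminated j) v = 0.

Lemma eliminates0 v : eliminates 0 v <-> v = 0.
Proof.
have [binj blt _ _] := basis; rewrite /eliminates eliminated0.
by split=> [|->]; [apply: (eval_inj d_gt0 piE) | rewrite eval0].
Qed.

Lemma eliminatesS j v : (j < size nonpures)%N ->
  eliminates j.+1 v <-> exists w, eliminates j (v - w *m relation j).
Proof.
move=> jc; have [binj _ _ _] := basis; rewrite /eliminates eliminatedS //.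
apply: (eval_setU1P piE binj residue_basis_closed); first exact: pi_eliminated.
exact: nonpure_notin.
Qed.

Lemma eliminates_regular j v : (j < size nonpures)%N ->
  eliminates j (v *m relation j) -> eliminates j v.
Proof.
move=> jc; have [binj _ _ _] := basis.
apply: (eval_regular piE binj residue_basis_closed); first exact: pi_eliminated.
exact: nonpure_notin.
Qed.

Lemma eliminates_size v : eliminates (size nonpures) v <-> augmentation v = 0.
Proof.
have evE : eval e beta setT v = amb_poly d (veronese_val (augmentation v)).
  rewrite augmentationE /eval rmorph_sum; apply: eq_bigr => b _.
  by rewrite subst_setT rmorphM.
rewrite /eliminates eliminated_size evE; split=> [|->]; last by rewrite rmorph0.
by rewrite -(rmorph0 (amb_poly d)) => /amb_poly_inj v0; apply: val_inj.
Qed.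

Lemma relationC i j : relation i *m relation j = relation j *m relation i.
Proof.
have [binj blt _ _] := basis.
exact: (relation_mxC K d_gt0 piE binj blt residue_basis_closed).
Qed.

Lemma hmatrix_relation j : hmatrix (fun b => basis_deg b + 1) basis_deg (relation j).
Proof.
move=> b b'; rewrite mxE; apply: homogeneousB.
  case: eqP => [->|_]; last by rewrite mul0r; apply: homogeneous0.
  rewrite mul1r addrAC subrr add0r -[1]/(1%N : int) -(mdeg1 (nonpure j)).
  exact: homogeneousX.
case: eqP => [b'E|_]; last by rewrite mul0r; apply: homogeneous0.
rewrite mul1r; set a := (_ + _)%MM in b'E *.
suff -> : basis_deg b + 1 - basis_deg b' = (mdeg (mnm_lift pi a))%:Z by apply: homogeneousX.
have := mdeg_mnm_lift piE a; rewrite -b'E mdegD mdeg_enum => /(congr1 Posz).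
rewrite !PoszD PoszM !basis_degE => aE.
have dn0 : d%:Z != 0 by rewrite eqz_nat -lt0n.
by apply: (mulIf dn0); lia.
Qed.

End Resolution.
End Augmentation.

(** * Graded resolutions and Ext *)

Local Notation gdeg F i := (@gf_deg _ _ _ _ F i).

Section GradedResolutions.
Variables (K : fieldType) (N : nat) (M : lmodType {mpoly K[N]}) (Mdeg : int -> M -> Prop).
Local Notation R := {mpoly K[N]}.
Implicit Types F G : graded_free_resolution Mdeg.

Lemma hmatrix_gf_diff F i : hmatrix (gdeg F i.+1) (gdeg F i) (gf_diff F i).
Proof.
move=> b b'.
have -> : gf_diff F i b b' =
    ((delta_mx 0 b : 'rV_(gf_rank F i.+1)) *m gf_diff F i) 0 b'.
  by rewrite -rowE mxE.
apply: gf_diff_graded => l; rewrite mxE /=.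
case: eqP => [->|_]; last exact: homogeneous0.
by rewrite subrr; apply: homogeneous1.
Qed.

Lemma gf_aug_delta F b : Mdeg (gdeg F 0 b) (gf_aug F (delta_mx 0 b)).
Proof.
apply: gf_aug_graded => l; rewrite mxE /=.
case: eqP => [->|_]; last exact: homogeneous0.
by rewrite subrr; apply: homogeneous1.
Qed.

Definition gf_projective F : projective_resolution M :=
  @ProjectiveResolution R M (fun i => 'rV[R]_(gf_rank F i)) (fun i => mulmxr (gf_diff F i))
    (gf_aug F) (fun i => @projective_rV R (gf_rank F i))
    (gf_aug_surj F) (@gf_aug_exact _ _ _ _ F) (@gf_diff_exact _ _ _ _ F).

Definition chain_map F G (f : forall i, 'M[R]_(gf_rank F i, gf_rank G i)) :=
  (forall x, gf_aug G (x *m f 0%N) = gf_aug F x) /\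
  forall i, f i.+1 *m gf_diff G i = gf_diff F i *m f i.

Lemma chain_map_exists F G : exists f, chain_map (F := F) (G := G) f.
Proof.
have [f [f0 fD]] := resolution_map (gf_projective F) (gf_projective G).
exists (fun i => lin1_mx (f i)); split=> [x|i]; first by rewrite mul_rV_lin1 -f0.
apply/row_matrixP => b; rewrite !rowE !mulmxA !mul_rV_lin1.
exact: (fD i).
Qed.

Definition cobounds F p (z : 'cV[R]_(gf_rank F p)) : Prop :=
  exists b, z = gf_diff_in F p *m b.

Lemma cobounds0 F p : @cobounds F p 0.
Proof. by exists 0; rewrite mulmx0. Qed.

Lemma cobounds_map F G f p z : chain_map (F := F) (G := G) f ->
  @cobounds G p z -> cobounds (f p *m z).
Proof.
case=> _ fD; case: p z => [|p] z [b ->]; first by rewrite mul0mx mulmx0; apply: cobounds0.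
by exists (f p *m b); rewrite mulmxA fD mulmxA.
Qed.

(** [f] lifts the identity of M, so f - 1 is null-homotopic and [f] induces the identity on
    cohomology of the dual. *)
Lemma cobounds_homotopy F f p z : chain_map (F := F) (G := F) f ->
  gf_diff F p *m z = 0 -> cobounds (f p *m z - z).
Proof.
case=> f0 fD z0.
have [x|i x|h [h0 hS]] := @resolution_homotopy _ _ (gf_projective F)
    (fun i => mulmxr (f i - 1%:M)).
- by rewrite /= mulmxBr mulmx1 linearB /= f0 subrr.
- by rewrite /= -!mulmxA mulmxBr mulmxBl fD mulmx1 mul1mx.
have hM i (x : 'rV[R]_(gf_rank F i)) : h i x = x *m lin1_mx (h i) by rewrite mul_rV_lin1.
case: p z z0 => [|p] z z0.
  suff -> : f 0%N *m z - z = 0 by apply: cobounds0.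
  rewrite -{2}[z]mul1mx -mulmxBl; apply/row_matrixP => b.
  by rewrite row0 rowE mulmxA [X in X *m _](h0 _) /= -mulmxA z0 mulmx0.
exists (lin1_mx (h p) *m z); rewrite -{2}[z]mul1mx -mulmxBl /=.
apply/row_matrixP => b; have /= hb := hS p (delta_mx 0 b).
by rewrite !rowE !mulmxA hb !hM mulmxDl -!mulmxA z0 !mulmx0 add0r.
Qed.

(* The comparison maps F -> P -> F vanish in degree p, so that the identity    *)
(* of F_p is null-homotopic.                                                   *)
Lemma cobounds_short F (P : projective_resolution M) p z :
  (forall x : pr_mod P p, x = 0) -> (0 < p)%N ->
  gf_diff F p *m z = 0 -> @cobounds F p z.
Proof.
case: p z => // p z P0 _ z0.
have [f [f0 fD]] := resolution_map (gf_projective F) P.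
have [g [g0 gD]] := resolution_map P (gf_projective F).
have [x|i x|h [_ hS]] := @resolution_homotopy _ _ (gf_projective F)
    (fun i => (g i \o f i) \- idfun).
- by rewrite /= linearB /= g0 f0 subrr.
- have /= gDx := gD i (f i.+1 x); have /= fDx := fD i x.
  by rewrite /= mulmxBl gDx fDx.
exists (- lin1_mx (h p) *m z); apply/row_matrixP => b.
have /= := hS p (delta_mx 0 b); rewrite (P0 (f _ _)) linear0 sub0r => hb.
rewrite !rowE -[delta_mx 0 b in LHS]opprK hb mulNmx mulmxDl -mulmxA z0 mulmx0 add0r.
by rewrite -(mul_rV_lin1 (h p)) /= mulNmx !mulmxN -!mulmxA.
Qed.

End GradedResolutions.

Section CohomologyLift.
Variables (R : comNzRingType) (l m q : nat) (A : 'M[R]_(m, l)) (B : 'M[R]_(q, m)).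

Lemma cohomology_ind (P : cohomology A B -> Prop) :
  (forall z, P (cohomology_class A z)) -> forall x, P x.
Proof. exact: quotmod_ind. Qed.

Lemma cohomology_class_eq (z z' : cocycle B) :
  cohomology_class A z = cohomology_class A z' <->
  exists b, cocycle_val z - cocycle_val z' = A *m b.
Proof.
have -> : (cohomology_class A z = cohomology_class A z') <-> (z - z' \in @coboundary R l m q A B).
  by rewrite Quotient.idealrBE; split=> [zz|/eqP //]; apply/eqP.
by rewrite unfold_in; split=> [/asboolP|] // zz; apply/asboolP.
Qed.

Lemma cohomology_lift (W : lmodType R) (g : {linear 'cV[R]_m -> W}) :
    (forall b, g (A *m b) = 0) ->
  exists f : {linear cohomology A B -> W},
    forall z, f (cohomology_class A z) = g (cocycle_val z).
Proof.
move=> gA.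
have rep (x : cohomology A B) :
    exists w, exists2 z, x = cohomology_class A z & w = g (cocycle_val z).
  by elim/cohomology_ind: x => z; exists (g (cocycle_val z)), z.
have [f fP] := choice rep.
have fE z : f (cohomology_class A z) = g (cocycle_val z).
  have [z' /cohomology_class_eq[b zb] ->] := fP (cohomology_class A z).
  by apply/esym/eqP; rewrite -subr_eq0 -linearB zb gA.
have f_lin : linear f.
  move=> a; elim/cohomology_ind=> x; elim/cohomology_ind=> y.
  have -> : a *: cohomology_class A x + cohomology_class A y = cohomology_class A (a *: x + y).
    by rewrite [RHS]quotmod_piD -quotmod_scaleE.
  by rewrite !fE -linearP.
by exists (HB.pack_for {linear cohomology A B -> W} f (GRing.isLinear.Build R _ _ _ f f_lin)).
Qed.

End CohomologyLift.

(** * The Koszul resolution and its dual *)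

Section VeroneseCanonical.
Variables (K : fieldType) (n d : nat) (e : monomial_enum n d).
Hypothesis d_gt0 : (0 < d)%N.
Local Notation N := 'C((n + d).-1, d).
Local Notation R := {mpoly K[N]}.
Local Notation resolution k := (graded_free_resolution (@veronese_deg K n d e k)).

(** The degree 0 part of any comparison map still commutes with the differentials and augmentations,
    as these are homogeneous. *)
Lemma graded_chain_map_exists k (F G : resolution k) : exists2 f,
  chain_map (F := F) (G := G) f & forall i, hmatrix (gdeg F i) (gdeg G i) (f i).
Proof.
have [f [f0 fD]] := chain_map_exists F G.
exists (fun i => hpart (gdeg F i) (gdeg G i) (f i)); last by move=> i; apply: hmatrix_hpart.
split=> [x|i]; last first.
  rewrite -(hpart_mulr _ _ (@hmatrix_gf_diff _ _ _ _ G i)) fD.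
  by rewrite (hpart_mull _ _ (@hmatrix_gf_diff _ _ _ _ F i)).
rewrite (row_comb_lin (f := gf_aug F) (fun=> erefl)) mulmx_sum_row linear_sum.
apply: eq_bigr => b _; rewrite linearZ /=; congr (_ *: _); apply: val_inj => /=.
have aF := @gf_aug_delta _ _ _ _ F b; rewrite -f0 -rowE in aF *.
have /hproj_id <- := aF.
rewrite -(veronese_hproj d_gt0 _ _ (@gf_aug_delta _ _ _ _ G)); congr (veronese_val (gf_aug G _)).
by apply/rowP => l; rewrite !mxE.
Qed.

Lemma hmatrix_free p q (a : 'I_p -> int) (b : 'I_q -> int) (D : 'M[R]_(p, q)) j x :
  hmatrix a b D -> free_homogeneous a j x -> free_homogeneous b j (x *m D).
Proof.
move=> hD hx l; rewrite mxE; apply: homogeneous_sum => i _.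
by rewrite -[j](subrK (a i)) -addrA; apply: homogeneousM.
Qed.

Section Koszul.
Variables (pi : 'I_n -> 'I_N) (i0 : 'I_N).
Hypothesis piE : forall j, tnth e (pi j) = (U_(j) *+ d)%MM.
Variables (k t r : nat) (beta : 'I_r -> 'X_{1..n}) (s : int).
Hypotheses (k_lt : (k < d)%N) (t_lt : (t < d)%N).
Hypothesis ktE : (n * d.-1)%:Z = k%:Z + t%:Z + s * d%:Z.
Hypothesis basis : residue_basis d k beta.

Let gamma b := [multinom (d.-1 - beta b j)%N | j < n].
Let T := relation K e pi i0 beta.
Let T' := relation K e pi i0 gamma.
Let c := size (nonpures pi).

Let basis' : residue_basis d t gamma.
Proof.
apply: residue_basis_compl basis => //.
case: s ktE => [q|q] kt.
  by rewrite (_ : n * d.-1 = q * d + (k + t))%N ?modnMDl //; lia.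
by rewrite (_ : k + t = q.+1 * d + n * d.-1)%N ?modnMDl //; lia.
Qed.

Let T'E j : T' j = (T j)^T.
Proof.
apply: relation_mx_tr => // b i; rewrite mnmE subnKC //.
by have [_ blt _ _] := basis; have := blt b i; lia.
Qed.

Let degE b : basis_deg d beta b + basis_deg d gamma b = s.
Proof.
have dn0 : d%:Z != 0 by rewrite eqz_nat -lt0n.
apply: (mulIf dn0); have := basis_degE d_gt0 k_lt basis b; have := basis_degE d_gt0 t_lt basis' b.
suff : (mdeg (beta b) + mdeg (gamma b) = n * d.-1)%N by move: ktE; lia.
rewrite -mdegD mdegE (eq_bigr (fun=> d.-1)) ?sum_nat_const ?card_ord // => j _.
by have [_ blt _ _] := basis; rewrite mnmDE mnmE; have := blt b j; lia.
Qed.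

Let kdeg_ := @koszul_deg r (basis_deg d beta) c.

Let J0 := @eliminates0 K n d e d_gt0 pi piE k r beta basis.
Let JS := @eliminatesS K n d e d_gt0 pi i0 piE k r beta basis.
Let Jreg := @eliminates_regular K n d e d_gt0 pi i0 piE k r beta basis.
Let TC := relationC K d_gt0 i0 piE basis.
Let hT j : hmatrix (fun b => basis_deg d beta b + 1) (basis_deg d beta) (T j) :=
  @hmatrix_relation K n d e d_gt0 pi i0 piE k r beta k_lt basis j.
Let aug := augmentation K e d_gt0 k_lt basis.
Let aug' := augmentation K e d_gt0 t_lt basis'.

Let aug_exact x : aug x = 0 <-> exists y : 'rV_(koszul_rank r c 1), x = y *m koszul_diff T c 0.
Proof.
have [exact0 _] := koszul_exact TC J0 JS Jreg (leqnn c).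
by rewrite -exact0 -(eliminates_size e d_gt0 pi).
Qed.

Let diff_exact i (x : 'rV_(koszul_rank r c i.+1)) :
  x *m koszul_diff T c i = 0 <->
    exists y : 'rV_(koszul_rank r c i.+2), x = y *m koszul_diff T c i.+1.
Proof.
have [_ exactS] := koszul_exact TC J0 JS Jreg (leqnn c).
split=> [/exactS //|[y ->]].
by rewrite -mulmxA (koszul_diffK TC) mulmx0.
Qed.

Let aug_graded (j : int) (x : 'rV[R]_r) :
  free_homogeneous (@kdeg_ 0%N) j x -> veronese_deg j (aug x).
Proof.
move=> hx; apply/hproj_id.
rewrite -(veronese_hproj d_gt0 j x (@augmentation_deg K n d e d_gt0 k r beta k_lt basis)).
congr (veronese_val (aug _)); apply/rowP => b; rewrite mxE; apply/hproj_id/hx.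
Qed.

Let diff_graded i (j : int) (x : 'rV[R]_(koszul_rank r c i.+1)) :
  free_homogeneous (@kdeg_ i.+1) j x -> free_homogeneous (@kdeg_ i) j (x *m koszul_diff T c i).
Proof.
move=> hx; apply: (hmatrix_free (@hmatrix_koszul_diff _ _ _ _ _ hT c i) hx).
Qed.

Definition koszul_resolution : resolution k :=
  GradedFreeResolution (augmentation_surj d_gt0 piE k_lt basis) aug_exact diff_exact
    aug_graded diff_graded.

Definition top_map (z : 'cV[R]_(koszul_rank r c c)) : veronese K e t :=
  aug' (koszul_top R r c *m z)^T.

Fact top_map_is_linear : linear top_map.
Proof. by move=> a x y; rewrite /top_map mulmxDr -scalemxAr !linearP. Qed.
HB.instance Definition _ := GRing.isLinear.Build R _ _ _ top_map top_map_is_linear.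

Lemma top_map_surj y : exists z, top_map z = y.
Proof.
have [v vy] := augmentation_surj d_gt0 piE t_lt basis' y.
by exists (koszul_top_inv R r c *m v^T); rewrite /top_map mulmxA koszul_topK mul1mx trmxK.
Qed.

(** Transposition turns the column images of T_j into the row images of the operators of [gamma],
    whose sum is the kernel of [aug']. *)
Lemma top_map_ker z : top_map z = 0 <-> top_cobounds T z.
Proof.
pose J j (w : 'cV[R]_r) := eliminates e pi gamma j w^T.
have J0' w : J 0%N w <-> w = 0.
  rewrite /J (@eliminates0 K n d e d_gt0 pi piE t r gamma basis').
  split=> [w0|->]; last by rewrite trmx0.
  by apply: trmx_inj; rewrite w0 trmx0.
have JS' j w : (j < c)%N -> J j.+1 w <-> exists x, J j (w - T j *m x).
  move=> jc; rewrite /J (eliminatesS d_gt0 i0 piE basis') //.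
  split=> -[x Jx]; exists x^T; move: Jx; rewrite linearB /= trmx_mul ?trmxK -T'E //.
by rewrite (top_coboundsP J0' JS' z (leqnn c)) /top_map /J -(eliminates_size e d_gt0 pi t_lt).
Qed.

(** Degree count: a cochain of degree j has b-th coordinate of degree [basis_deg d beta b] + c + j,
    and it multiplies a generator of degree s - [basis_deg d beta b]. The shift is therefore s +
    c. *)
Lemma top_map_hproj (j : int) z :
  veronese_val (top_map (hpart (@kdeg_ c) (fun=> - j) z)) =
  hproj (t%:Z + (j + (s + c%:Z)) * d%:Z) (veronese_val (top_map z)).
Proof.
rewrite /top_map -(hpart_mull _ _ (@hmatrix_koszul_top K N r (basis_deg d beta) c)).
rewrite -(veronese_hproj d_gt0 _ _ (@augmentation_deg K n d e d_gt0 t r gamma t_lt basis')).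
congr (veronese_val (aug' _)); apply/rowP => b; rewrite !mxE -(degE b).
by congr hproj; lia.
Qed.

End Koszul.
End VeroneseCanonical.

Lemma top_coboundsE (R : comNzRingType) r (T : nat -> 'M[R]_r) p (z : 'cV[R]_(koszul_rank r p p)) :
  top_cobounds T z <-> exists b, z = (match p as p0
      return 'M[R]_(koszul_rank r p p0, if p0 is q.+1 then koszul_rank r p q else 0) with
    | 0 => 0 | q.+1 => koszul_diff T p q end) *m b.
Proof.
case: p z => [|p] z //=.
by split=> [->|[b ->]]; [exists 0; rewrite mulmx0 | rewrite mul0mx].
Qed.

(** * Projective dimension and independence of the resolution *)

Section DualResolution.
Variables (K : fieldType) (n d : nat) (e : monomial_enum n d).
Local Notation N := 'C((n + d).-1, d).
Local Notation R := {mpoly K[N]}.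
Local Notation resolution k := (graded_free_resolution (@veronese_deg K n d e k)).

(* [theta] identifies the top cohomology of the dual of F with S_(n,d,t), up  *)
(* to the shift s.                                                            *)
Record dual_resolution k t (F : resolution k) c (s : int)
    (theta : {linear 'cV[R]_(gf_rank F c) -> veronese K e t}) : Prop := DualResolution {
  dual_rank : forall i, (c < i)%N -> gf_rank F i = 0%N;
  dual_surj : forall y, exists z, theta z = y;
  dual_ker : forall z, theta z = 0 <-> cobounds z;
  dual_hproj : forall j z,
    veronese_val (theta (hpart (gdeg F c) (fun=> - j) z)) =
    hproj (t%:Z + (j + s) * d%:Z) (veronese_val (theta z))
}.

Lemma dual_resolution_exists k t (q : int) : (0 < n)%N -> (0 < d)%N -> (k < d)%N -> (t < d)%N ->
    (n * d.-1)%:Z = k%:Z + t%:Z + q * d%:Z ->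
  exists F c s theta, @dual_resolution k t F c s theta.
Proof.
move=> n_gt0 d_gt0 k_lt t_lt ktE.
have pure_ex j : exists i, tnth e i = (U_(j) *+ d)%MM.
  have : (U_(j) *+ d)%MM \in (e : seq _) by rewrite monomials_mem inE mdegMn mdeg1 mul1n.
  by case/tnthP => i ->; exists i.
have [pi piE] := choice pure_ex; pose i0 := pi (Ordinal n_gt0).
have [r [beta basis]] := residue_basis_exists n d k.
exists (koszul_resolution K d_gt0 i0 piE k_lt basis), (size (nonpures pi)),
  (q + (size (nonpures pi))%:Z).
exists (top_map e d_gt0 (pi := pi) k_lt t_lt ktE basis).
split=> [i ci|y|z|j z].
- exact: koszul_rank_gt.
- exact: top_map_surj.
- by rewrite (top_map_ker d_gt0 i0 piE); apply: top_coboundsE.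
exact: top_map_hproj.
Qed.

Section Canonical.
Variables (k t : nat) (F : resolution k) (c : nat) (s : int).
Variable theta : {linear 'cV[R]_(gf_rank F c) -> veronese K e t}.
Hypothesis dualF : dual_resolution s theta.
Hypotheses (d_gt0 : (0 < d)%N) (n_gt0 : (0 < n)%N).

Lemma above_top (m : nat) i (A : 'M[R]_(gf_rank F i, m)) : (c < i)%N -> A = 0.
Proof.
move=> ci; apply/matrixP => -[l hl]; exfalso; move: hl.
by rewrite (dual_rank dualF ci).
Qed.

Lemma veronese_nonzero : exists y : veronese K e t, y <> 0.
Proof.
have mem : 'X_[U_(Ordinal n_gt0) *+ t] \in @veronese_pred K n d t.
  apply/veronese_predP => m; rewrite msuppX inE => /eqP ->.
  by exists 0%N; rewrite mdegMn mdeg1 mul1n mul0n addn0.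
exists (Veronese mem) => /(congr1 (@veronese_val K n d e t)) /=
  /(congr1 (mcoeff (U_(Ordinal n_gt0) *+ t))).
by rewrite mcoeffX eqxx mcoeff0 => /eqP; rewrite oner_eq0.
Qed.

(** A projective resolution of length q < c would make every cochain in degree c a coboundary, hence
    [theta] zero, although it maps onto a nonzero module. *)
Lemma projective_dimension_top : has_projective_dimension (veronese K e k) c.
Proof.
split.
  exists (gf_projective F) => i ci x; apply/rowP => -[l hl]; exfalso; move: hl.
  by rewrite (dual_rank dualF ci).
move=> q [P Pq]; rewrite leqNgt; apply/negP => qc.
have [y ynz] := veronese_nonzero; have [z zy] := dual_surj dualF y.
apply: ynz; rewrite -zy; apply/(dual_ker dualF).
apply: (@cobounds_short _ _ _ _ F P); [exact: Pq|exact: leq_ltn_trans qc|].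
by rewrite (above_top (gf_diff F c)) ?mul0mx.
Qed.

(** Pull cocycles of [G] back to [F] along [psi] and apply [theta]. The opposite map [phi] gives
    bijectivity, as both composites are homotopic to the identity; only [psi] has to be graded. *)
Lemma ext_iso (G : resolution k) :
  graded_iso_up_to_shift (@Ext_deg _ _ _ _ G c) (@veronese_deg K n d e t).
Proof.
have [psi psiM psi_deg] := graded_chain_map_exists d_gt0 F G.
have [phi phiM] := chain_map_exists G F.
have compM (A B C : resolution k) f g : chain_map (F := A) (G := B) f ->
    chain_map (F := B) (G := C) g -> chain_map (F := A) (G := C) (fun i => f i *m g i).
  move=> [f0 fD] [g0 gD]; split=> [x|i]; first by rewrite mulmxA g0 f0.
  by rewrite -mulmxA gD mulmxA fD mulmxA.
pose g : {linear 'cV[R]_(gf_rank G c) -> veronese K e t} := theta \o mulmx (psi c).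
have [|f fE] := @cohomology_lift _ _ _ _ (gf_diff_in G c) (gf_diff G c) _ g.
  by move=> b; apply/(dual_ker dualF)/(cobounds_map psiM); exists b.
have f_inj : injective f.
  elim/cohomology_ind=> x; elim/cohomology_ind=> y; rewrite !fE => /eqP.
  rewrite -subr_eq0 -linearB => /eqP /(dual_ker dualF) /(cobounds_map phiM)[b xyb].
  have [|b' xyb'] := cobounds_homotopy (z := cocycle_val x - cocycle_val y)
    (compM _ _ _ _ _ phiM psiM).
    by rewrite mulmxBr; case: x y {xyb} => x /eqP -> [y /eqP ->]; rewrite subrr.
  apply/cohomology_class_eq; exists (b - b').
  by rewrite mulmxBr -xyb -xyb' mulmxA subKr.
have f_surj y : exists x, f x = y.
  have [w <-] := dual_surj dualF y.
  have w0 : gf_diff F c *m w = 0 by rewrite (above_top (gf_diff F c)) ?mul0mx.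
  have phiw : phi c *m w \in cocycle_pred (gf_diff G c).
    by apply/eqP; case: phiM => _ phiD; rewrite mulmxA -phiD -mulmxA w0 mulmx0.
  exists (cohomology_class _ (Cocycle phiw)); rewrite fE /= /g /=.
  apply/eqP; rewrite -subr_eq0 -linearB /=; apply/eqP/(dual_ker dualF).
  by rewrite mulmxA; apply: (cobounds_homotopy (compM _ _ _ _ _ psiM phiM)).
exists s, f; split.
  have [f' f'K] := choice f_surj.
  by exists f' => [x|//]; apply: f_inj; rewrite f'K.
have f_hproj j (z z' : cocycle (gf_diff G c)) :
    cocycle_val z' = hpart (gdeg G c) (fun=> - j) (cocycle_val z) ->
    veronese_val (f (cohomology_class _ z')) =
    hproj (t%:Z + (j + s) * d%:Z) (veronese_val (f (cohomology_class _ z))).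
  move=> z'E; rewrite !fE z'E /g /= -(hpart_mull _ _ (psi_deg c)).
  exact: (dual_hproj dualF).
move=> j x; split=> [[z -> hz]|].
  apply/hproj_id; rewrite -(f_hproj j z z) //.
  by apply/esym/hpart_id => b b'; rewrite opprK ord1; apply: hz.
elim/cohomology_ind: x => z /hproj_id fz.
(* A class with homogeneous image is represented by the degree j part of any of its cocycles: both
   have the same image, and [f] is injective. *)
have z'P : hpart (gdeg G c) (fun=> - j) (cocycle_val z) \in cocycle_pred (gf_diff G c).
  apply/eqP; rewrite -(hpart_mull _ _ (@hmatrix_gf_diff _ _ _ _ G c)).
  have /eqP -> : gf_diff G c *m cocycle_val z == 0 by case: z {fz}.
  by apply/matrixP => b b'; rewrite !mxE linear0.
exists (Cocycle z'P); last by move=> b; rewrite /= mxE opprK; apply: hproj_homogeneous.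
apply/esym/f_inj/val_inj; exact: etrans (f_hproj j z (Cocycle z'P) erefl) fz.
Qed.

End Canonical.
End DualResolution.

Theorem theorem4 (K : fieldType) (n d k t : nat) (e : monomial_enum n d) :
  (1 <= n)%N -> (1 <= d)%N -> (k < d)%N ->
  (t%:Z = - n%:Z - k%:Z %[mod d%:Z])%Z -> (t < d)%N ->
  is_canonical_module (@veronese_deg K n d e k) (@veronese_deg K n d e t).
Proof.
move=> n_gt0 d_gt0 k_lt tE t_lt.
have [q qE] : exists q : int, (n * d.-1)%:Z = k%:Z + t%:Z + q * d%:Z.
  have /eqP := tE; rewrite eqz_mod_dvd => /dvdzP[q qE].
  (* From t + n + k = q d follows n(d-1) = k + t + (n - q) d. *)
  by exists (n%:Z - q); have := qE; rewrite mulrBl; nia.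
have [F [c [s [theta dualF]]]] := dual_resolution_exists K e n_gt0 d_gt0 k_lt t_lt qE.
exists c; split; first exact: (projective_dimension_top dualF).
  by exists; exact: F.
by move=> G; exact: (ext_iso dualF).
Qed.
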